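(* Let $(\mathcal{S}_\alpha)_{\alpha<\omega_1}$ be a transfinite Schreier sequence, let $1\leqslant\alpha<\omega_1$ and $p\in[1,\infty)$, and assume that $(\mathcal{S}_\alpha)_{\alpha<\omega_1}$ is good if $p\in(1,\infty)\setminus\{2\}$. Let $\mathbb{S}$ be the unit sphere of $X_{\mathcal{S}_\alpha,p}$ and let $T:\mathbb{S}\to\mathbb{S}$ be a surjective isometry. Then there exists a sequence of signs $(\theta_i)_{i\in\mathbb{N}}$ (i.e. $\theta_i\in\{-1,1\}$) such that for any $x\in\mathbb{S}$ and $i\in\mathbb{N}$, we have $T(x)(i)=\theta_i\,x(i)$.
   Context: All vector spaces are real; $\mathbb{N}$ starts at $1$; $\omega_1$ is the first uncountable ordinal; an isometry is a distance-preserving map. For finite sets $E,E'\subset\mathbb{N}$ and $n\in\mathbb{N}$, $n\leqslant E$ means $n\leqslant\min E$ and $E<E'$ means $\max E<\min E'$; these are considered true whenever one of the sets involved is empty. A transfinite Schreier sequence is a sequence $(\mathcal{S}_\alpha)_{0\leqslant\alpha<\omega_1}$ of families of finite subsets of $\mathbb{N}$ such that: $\mathcal{S}_0=\{F\subset\mathbb{N}: |F|\leqslant1\}$; $\mathcal{S}_{\beta+1}=\{\bigcup_{i=1}^nE_i:\ n\in\mathbb{N},\ n\leqslant E_1<E_2<\dots<E_n,\ E_i\in\mathcal{S}_\beta\}$ for every $\beta<\omega_1$; and for limit $\alpha$, $\mathcal{S}_\alpha=\{F\subset\mathbb{N}: F\in\mathcal{S}_{\alpha_n}\text{ for some }n\leqslant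 F\}$, where $(\alpha_n)_{n\in\mathbb{N}}$ is a preassigned strictly increasing sequence of non-zero ordinals with $\sup_n\alpha_n=\alpha$ (the approximating sequence of $\alpha$). The sequence $(\mathcal{S}_\alpha)_{\alpha<\omega_1}$ is good if for every limit ordinal $\alpha<\omega_1$ the approximating sequence consists of successor ordinals $\alpha_n=\beta_n+1$ and $(\mathcal{S}_{\beta_n})_{n\in\mathbb{N}}$ is increasing for inclusion. Let $c_{00}$ be the space of finitely supported real sequences, with canonical basis $(e_i)_{i\in\mathbb{N}}$. For $p\in[1,\infty)$, $X_{\mathcal{S}_\alpha,p}$ is the completion of $c_{00}$ for the norm $\|x\|=\sup\{(\sum_{i\in F}|x(i)|^p)^{1/p}: F\in\mathcal{S}_\alpha\}$. The sequence $(e_i)$ is a $1$-unconditional Schauder basis of $X_{\mathcal{S}_\alpha,p}$, and $x(i)$ denotes the $i$-th coordinate of $x$ with respect to it. *)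

(* Defs.v *)
From HB Require Import structures.
From mathcomp Require Import all_boot all_order all_algebra.
From mathcomp Require Import finmap.
From mathcomp Require Import all_classical all_reals all_analysis.
Set Implicit Arguments.
Unset Strict Implicit.
Unset Printing Implicit Defensive.
Import Order.TTheory GRing.Theory Num.Theory.
Import numFieldNormedType.Exports.
Local Open Scope classical_set_scope.
Local Open Scope ring_scope.

(* The index set {1, 2, 3, ...} of the mathematics is represented by nat
   through the order isomorphism k |-> k.+1: the term k : nat stands for the
   integer k.+1.  This applies to elements of finite sets, to coordinates and
   to the indices of approximating sequences.  Comparisons such as
   "n <= E" are unaffected by the shift, but a union of k.+1 sets is a union
   of "n" sets for the n represented by k. *)

Section Ordinals.
Context {d : Order.disp_t} {W : orderType d}.
Implicit Types a b c : W.

Definition ord_zero a := forall b, (a <= b)%O.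

Definition ord_succ b a := (b < a)%O /\ forall c, (b < c)%O -> (a <= c)%O.

Definition ord_limit a := ~ ord_zero a /\ ~ exists b, ord_succ b a.

End Ordinals.

(* W is order-isomorphic to the set of all ordinals a < omega_1: a well-order
   is isomorphic to omega_1 exactly when it is uncountable and all its proper
   initial segments are countable. *)
Definition is_omega1 (d : Order.disp_t) (W : orderType d) :=
  [/\ well_founded (fun a b : W => (a < b)%O),
      forall a : W, countable [set b : W | (b < a)%O]
    & ~ countable [set: W]].

Definition le_fset (n : nat) (E : {fset nat}) := forall i, i \in E -> (n <= i)%N.

Definition lt_fset (E E' : {fset nat}) :=
  forall i j, i \in E -> j \in E' -> (i < j)%N.

(* The relation n <= E_1 < ... < E_n is required between all the terms of the
   chain and not only between consecutive ones: some of the E_i may be empty,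
   and a comparison involving an empty set is vacuously true. *)
Definition schreier_succ (F : set {fset nat}) : set {fset nat} :=
  [set A | exists (k : nat) (E : 'I_k.+1 -> {fset nat}),
     [/\ forall i, le_fset k (E i),
         forall i j : 'I_k.+1, (i < j)%N -> lt_fset (E i) (E j),
         forall i, F (E i)
       & forall m, m \in A <-> exists i, m \in E i]].

Section Schreier.
Context {d : Order.disp_t} {W : orderType d}.

(* appr a is the approximating sequence of a; it is irrelevant when a is not a
   limit ordinal. *)
Record transfinite_schreier (appr : W -> nat -> W)
    (S : W -> set {fset nat}) : Prop := TransfiniteSchreier {
  appr_neq0 : forall a, ord_limit a -> forall n, ~ ord_zero (appr a n);
  appr_incr : forall a, ord_limit a ->
    forall m n, (m < n)%N -> (appr a m < appr a n)%O;
  appr_sup : forall a, ord_limit a -> supremums (range (appr a)) a;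
  schreier0 : forall a, ord_zero a -> S a = [set A | (#|` A| <= 1)%N];
  schreierS : forall b a, ord_succ b a -> S a = schreier_succ (S b);
  schreierL : forall a, ord_limit a ->
    S a = [set A | exists2 n, le_fset n A & S (appr a n) A]
}.

Definition good_schreier (appr : W -> nat -> W) (S : W -> set {fset nat}) :=
  forall a, ord_limit a ->
    exists b : nat -> W, (forall n, ord_succ (b n) (appr a n)) /\
      (forall n, S (b n) `<=` S (b n.+1)).

End Schreier.

Section C00.
Variable R : realType.

Definition finitely_supported : pred (nat -> R^o) :=
  fun x => `[< exists n, forall i, (n <= i)%N -> x i = 0 >].

Lemma finitely_supported_submod : submod_closed finitely_supported.
Proof.
split; first by apply/asboolP; exists 0%N.
move=> a x y /asboolP[n xn] /asboolP[m ym]; apply/asboolP.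
exists (maxn n m) => i; rewrite geq_max => /andP[ni mi].
by rewrite -[LHS]/(a *: x i + y i) xn// ym// scaler0 addr0.
Qed.

HB.instance Definition _ :=
  GRing.isSubmodClosed.Build R (nat -> R^o) finitely_supported
    finitely_supported_submod.

Record c00 := C00 {
  c00_fun :> nat -> R^o;
  c00_supp : c00_fun \in finitely_supported
}.

HB.instance Definition _ := [isSub for c00_fun].
HB.instance Definition _ := [Choice of c00 by <:].
HB.instance Definition _ := [SubChoice_isSubLmodule of c00 by <:].

Lemma c00_basis_subproof (i : nat) :
  (fun j => (j == i)%:R : R^o) \in finitely_supported.
Proof. by apply/asboolP; exists i.+1 => j ij; rewrite gtn_eqF. Qed.

Definition c00_basis (i : nat) : c00 := C00 (c00_basis_subproof i).

End C00.

Section Space.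
Variable R : realType.

Definition schreier_norm (F : set {fset nat}) (p : R) (x : c00 R) : R :=
  sup [set (\sum_(i <- A) `|x i| `^ p) `^ p^-1 | A in F].

(* (X, iota) is a completion of c00 for the norm above; it is unique up to a
   linear isometry compatible with iota. *)
Definition is_completion (F : set {fset nat}) (p : R)
    (X : completeNormedModType R) (iota : {linear c00 R -> X}) :=
  (forall x, `|iota x| = schreier_norm F p x) /\ dense (range iota).

(* The coordinates of x with respect to the Schauder basis e: the scalars c
   such that x is the limit of the partial sums of \sum_i c i *: e i. *)
Definition schauder_coord (X : normedModType R) (e : nat -> X) (x : X) : nat -> R :=
  get [set c : nat -> R | series (fun i => c i *: e i) @ \oo --> x].

Definition unit_sphere (X : normedModType R) : set X := [set x | `|x| = 1].

Definition isometry_on (X : normedModType R) (A : set X) (T : X -> X) :=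
  forall x y, A x -> A y -> `|T x - T y| = `|x - y|.

End Space.
Arguments unit_sphere {R} X.

(* Main.v *)
(* Since {1} is the only member of S alpha containing 1 (index 0
   below), X is the l_infinity-sum of a line R e_0 and a space Y.  The pair
   {e_0, -e_0} is characterized metrically among antipodal pairs of the sphere,
   so T maps e_0 + Ball(Y) onto itself, up to a global sign; the Mazur-Ulam
   argument in a ball then gives a linear isometry g of X with
   T (e_0 + y) = e_0 + g y.  A maximal set A of S alpha is detected by the
   norm near a flat vector supported on A, which forces g to permute the basis
   up to signs, and the permutation is trivial because a set of S alpha with a
   larger minimum can be longer.  Finally g^-1 T fixes e_0 + Ball(Y), and one
   descends from the level s = 1 to s = -1 in small steps: a point of
   s e_0 + S(Y) is determined by its distances larger than d to the points of
   a level at distance at most d. *)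
From HB Require Import structures.
Require Import Defs.
From mathcomp Require Import all_boot all_order all_algebra.
From mathcomp Require Import finmap.
From mathcomp Require Import all_classical all_reals all_analysis.
From mathcomp Require Import zify lra.
Import Order.TTheory GRing.Theory Num.Theory.
Import numFieldNormedType.Exports.
Local Open Scope classical_set_scope.
Local Open Scope fset_scope.
Local Open Scope ring_scope.
Set Implicit Arguments.
Unset Strict Implicit.
Unset Printing Implicit Defensive.

(** * Combinatorics of the transfinite Schreier families *)

Section Family.
Context {d : Order.disp_t} {W : orderType d}.
Context (appr : W -> nat -> W) (S : W -> set {fset nat}).
Context (Wwf : well_founded (fun a b : W => (a < b)%O)).
Context (hS : transfinite_schreier appr S).

(** In the l_infinity-sum the distance between [s *: e_0 + y] and [r *: e_0 + z] is the maximum of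
    |s - r| and |y - z|. Hence a level s on which the map is known to be the identity tells about
    the level r only distances cut off below |s - r|. This forbids a jump from s = 1 to s = -1, and
    it makes the small coordinates of y the obstacle: a distance that detects them must stay above
    the cut-off. The error made by discarding all small coordinates together is proportional to the
    size of the support M, whence the condition 8 d |M| <= 1 on the step d, the restriction of the
    descent to finitely supported vectors, and a passage to the limit at the end. The linear part
    depends on p. For p > 1 strict convexity recovers the zero sets of the coordinates. *)

Lemma ord_ind (P : W -> Prop) :
  (forall a, ord_zero a -> P a) ->
  (forall b a, ord_succ b a -> P b -> P a) ->
  (forall a, ord_limit a -> (forall n, P (appr a n)) -> P a) ->
  forall a, P a.
Proof.
move=> P0 PS PL; apply: (well_founded_ind Wwf) => a IH.
have [|a0] := pselect (ord_zero a); first exact: P0.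
have [[b ba]|aS] := pselect (exists b, ord_succ b a).
  by apply: (PS b) => //; apply: IH; case: ba.
have aL : ord_limit a by [].
apply: PL => // n; apply: IH.
apply: (lt_le_trans (appr_incr hS aL (ltnSn n))).
by have [+ _] := appr_sup hS aL; apply; exists n.+1.
Qed.

(* Heredity (phi = id) and spreading in a single induction. *)
Lemma schreier_dom (a : W) (A B : {fset nat}) (phi : nat -> nat) :
  S a A -> {in B, forall b, phi b \in A /\ (phi b <= b)%N} ->
  {in B &, {mono phi : x y / (x < y)%N}} -> S a B.
Proof.
elim/ord_ind: a A B => [a a0|b a ba IH|a aL IH] A B.
- rewrite !(schreier0 hS)//= => A1 phiA phim.
  have phi_inj : {in B &, injective phi}.
    by move=> x y xB yB phixy; have [||//] := ltngtP x y; rewrite -phim// phixy ltnn.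
  apply: leq_trans A1; rewrite -(card_in_imfset imfset_key phi_inj).
  by apply: fsubset_leq_card; apply/fsubsetP => _ /imfsetP[x xB ->]; case: (phiA x xB).
- rewrite !(schreierS hS ba) => -[k [E [kE EE bE AE]]] phiA phim.
  exists k, (fun i => [fset x in B | phi x \in E i]); split.
  + by move=> i x; rewrite !inE => /andP[/phiA[_ /[swap] /kE]]; exact: leq_trans.
  + move=> i j ij x y; rewrite !inE => /andP[xB xE] /andP[yB yE].
    by rewrite -phim//; apply: EE xE yE.
  + move=> i; apply: IH (bE i) _ _ => [x|x y]; rewrite !inE.
      by move=> /andP[/phiA[]].
    by move=> /andP[xB _] /andP[yB _]; exact: phim.
  + move=> m; split=> [mB|[i]]; last by rewrite !inE => /andP[].
    by have [/AE[i phim_E] _] := phiA m mB; exists i; rewrite !inE mB.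
- rewrite !(schreierL hS)// => -[n nA SA] phiA phim; exists n.
    by move=> x /phiA[/nA nx]; exact: leq_trans.
  exact: IH SA phiA phim.
Qed.

Lemma schreier_sub (a : W) (A B : {fset nat}) : S a A -> B `<=` A -> S a B.
Proof.
move=> SA /fsubsetP BA; apply: (schreier_dom (phi := id)) SA _ _ => //.
by move=> b /BA.
Qed.

Lemma schreier1 (a : W) (i : nat) : S a [fset i].
Proof.
elim/ord_ind: a => [a a0|b a ba IH|a aL IH].
- by rewrite (schreier0 hS)//= cardfs1.
- rewrite (schreierS hS ba); exists 0%N, (fun=> [fset i]); split => //.
    by move=> [[]]// ? [[]].
  by move=> m; split=> [|[]//]; exists ord0.
- by rewrite (schreierL hS)//; exists 0%N.
Qed.

Lemma schreier_set0 (a : W) : S a fset0.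
Proof. exact: schreier_sub (schreier1 a 0) (fsub0set _). Qed.

(** At a successor stage a set of [k.+1] blocks has [k] below all its elements, so a set that
    contains 0 consists of a single block. *)
Lemma schreier_min0 (a : W) (A : {fset nat}) : S a A -> 0%N \in A -> A = [fset 0%N].
Proof.
elim/ord_ind: a A => [a a0|b a ba IH|a aL IH] A.
- rewrite (schreier0 hS)//= => A1 A0; apply/esym/eqP.
  by rewrite eqEfcard fsub1set A0 cardfs1.
- rewrite (schreierS hS ba) => -[k [E [kE EE bE AE]]] /AE[i Ei0].
  have k0 : k = 0%N by apply/eqP; rewrite -leqn0; apply: kE Ei0.
  subst k; rewrite -(IH (E i))//; apply/fsetP => m; apply/idP/idP.
    by move=> /AE[j]; rewrite (ord1 j) (ord1 i).
  by move=> mE; apply/AE; exists i.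
- by rewrite (schreierL hS)// => -[n _ /IH].
Qed.

Lemma schreier2 (a : W) (i j : nat) : ~ ord_zero a -> (0 < i)%N -> (0 < j)%N ->
  S a [fset i; j].
Proof.
wlog ij : i j / (i < j)%N => [wl|].
  have [ij|ji|->] := ltngtP i j; first exact: wl.
    by rewrite fsetUC => *; exact: wl.
  by rewrite fsetUid => *; exact: schreier1.
elim/ord_ind: a => [//|b a ba _|a aL IH] a0 i0 j0.
- rewrite (schreierS hS ba).
  (* Two blocks mean [k = 1], which is below both singletons because 0 is excluded. *)
  exists 1%N, (fun k : 'I_2 => if k == ord0 then [fset i] else [fset j]); split.
  + by move=> k x; case: ifP => _; rewrite !inE => /eqP ->.
  + by move=> [[|[|]]//= ?] [[|[|]]//= ?] _ x y; rewrite !inE => /eqP-> /eqP->.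
  + by move=> k; case: ifP => _; exact: schreier1.
  + move=> m; rewrite !inE; split=> [/orP[mi|mj]|[k]].
    * by exists ord0; rewrite !inE.
    * by exists (lift ord0 ord0); rewrite !inE.
    * by case: ifP; rewrite !inE => _ ->//; rewrite orbT.
- rewrite (schreierL hS)//; exists 0%N => //.
  by apply: IH => //; exact: appr_neq0 hS _ aL _.
Qed.

(* A decomposition into blocks may have more blocks when the minimum is larger,
   so the singleton of k can be a block of its own. *)
Lemma schreier_dom_rcons (a : W) (A B : {fset nat}) (phi : nat -> nat) (b0 k : nat) :
  ~ ord_zero a ->
  S a A -> {in B, forall b, phi b \in A /\ (phi b <= b)%N} ->
  {in B &, {mono phi : x y / (x < y)%N}} ->
  b0 \in B -> {in B, forall b, (b0 <= b)%N} -> (phi b0 < b0)%N ->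
  {in B, forall b, (b < k)%N} -> S a (k |` B).
Proof.
elim/ord_ind: a A B => [//|b a ba _|a aL IH] A B a0.
- rewrite !(schreierS hS ba) => -[r [E [rE EE bE AE]]] phiA phim b0B b0min b0phi Bk.
  have rb0 : (r < b0)%N.
    have [/AE[i]] := phiA _ b0B; move=> /rE + _.
    by move=> /leq_ltn_trans; apply.
  exists r.+1, (fun i => if unlift ord_max i is Some j then
    [fset x in B | phi x \in E j] else [fset k]); split.
  + move=> i x; case: unliftP => [j _|_]; rewrite !inE.
      by move=> /andP[/b0min + _]; exact: leq_trans.
    by move=> /eqP ->; apply: leq_ltn_trans (Bk _ b0B); exact: ltnW.
  + move=> i j ij x y.
    case: (unliftP ord_max i) => [i' ii'|im]; last first.
      by move: ij; rewrite im ltnNge -ltnS ltn_ord.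
    rewrite !inE => /andP[xB xE].
    case: (unliftP ord_max j) => [j' jj'|jm]; rewrite !inE.
      move=> /andP[yB yE]; rewrite -phim//.
      by apply: EE xE yE; move: ij; rewrite ii' jj' !lift_max.
    by move=> /eqP->; exact: Bk.
  + move=> i; case: unliftP => [j _|_]; last exact: schreier1.
    apply: (schreier_dom (bE j) (phi := phi)) => [x|x y]; rewrite !inE.
      by move=> /andP[/phiA[]].
    by move=> /andP[xB _] /andP[yB _]; exact: phim.
  + move=> m; rewrite !inE; split.
      move=> /orP[/eqP->|mB]; first by exists ord_max; rewrite unlift_none inE.
      have [/AE[i mE] _] := phiA m mB.
      by exists (lift ord_max i); rewrite liftK !inE mB.
    move=> [i]; case: unliftP => [j _|_]; rewrite !inE; last by move->.
    by move=> /andP[->]; rewrite orbT.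
- rewrite !(schreierL hS)// => -[n nA SA] phiA phim b0B b0min b0phi Bk; exists n.
    move=> x; rewrite !inE => /orP[/eqP->|xB].
      by apply: leq_trans (ltnW (Bk _ b0B)); have [/nA /leq_trans] := phiA _ b0B; apply.
    by have [/nA/leq_trans] := phiA _ xB; apply.
  by apply: IH SA phiA phim b0B b0min b0phi Bk; exact: appr_neq0 hS _ aL _.
Qed.

(** Compactness of the family: it cannot contain all initial segments of an infinite set. The
    induction needs segments starting at an arbitrary [s]. The minimum [k s] bounds the number of
    blocks in the successor case, and the index in the approximating sequence in the limit case. *)
Lemma schreier_no_chain (a : W) (k : nat -> nat) :
  {homo k : m n / (m < n)%N} ->
  exists n, ~ S a [fset k i | i in iota 0 n].
Proof.
move=> kincr.
have kinj : injective k.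
  move=> x y kxy; have [/kincr|/kincr|//] := ltngtP x y; by rewrite kxy ltnn.
suff : forall s, exists n, ~ S a [fset k i | i in iota s n] by move/(_ 0%N).
elim/ord_ind: a => [a a0|b a ba IH|a aL IH] s.
- exists 2%N; rewrite (schreier0 hS)//= (card_imfset _ _ kinj)/=.
  by rewrite inE eqn_leq ltnn andbF.
- pose covers r j n := exists E : 'I_r -> {fset nat},
    [/\ forall i j : 'I_r, (i < j)%N -> lt_fset (E i) (E j), forall i, S b (E i)
      & forall i, (j <= i < n)%N -> exists l, k i \in E l].
  (* The first block, a member of [S b], misses a point of index below [j + l]. That point lies in a
     later block, so the first block covers nothing from [j + l] on and only the other blocks
     remain. *)
  have noncover r : forall j, exists n, ~ covers r j n.
    elim: r => [|r IHr] j.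
      exists j.+1 => -[E [_ _ /(_ j)]]; rewrite leqnn ltnSn.
      by move=> /(_ isT)[[]].
    have [l Sl] := IH j; have [n nc] := IHr (j + l)%N.
    exists (maxn n (j + l)) => -[E [EE bE cE]].
    have [x xl xE] : exists2 x, (j <= x < j + l)%N & k x \notin E ord0.
      apply: contrapT => nx; apply: Sl; apply: schreier_sub (bE ord0) _.
      apply/fsubsetP => _ /imfsetP[x /= + ->]; rewrite mem_iota => xl.
      by apply: contrapT => /negP xE; apply: nx; exists x.
    apply: nc; exists (fun i => E (lift ord0 i)); split=> // [i i' ii'|i /andP[li ni]].
      by apply: EE; rewrite !lift0.
    have [|u] := cE i.
      by rewrite leq_max ni andbT (leq_trans _ li)// leq_addr.
    have [|u'] := cE x; first by case/andP: xl => -> /= xl; rewrite leq_max xl orbT.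
    case: (unliftP ord0 u') => [u'' -> xu'' iu|->]; last by rewrite (negbTE xE).
    case: (unliftP ord0 u) iu => [v ->|->]; first by exists v.
    move=> iE; have := EE ord0 (lift ord0 u'') isT _ _ iE xu''.
    have xi : (x < i)%N by case/andP: xl => _ /leq_trans; apply.
    by move=> /(ltn_trans (kincr _ _ xi)); rewrite ltnn.
  have [n nc] := noncover (k s).+1 s.
  have ncle r : (r <= k s)%N -> ~ covers r.+1 s n.
    move=> rs [E [EE bE cE]]; apply: nc.
    (* A shorter chain of blocks is padded with empty ones. *)
    exists (fun i => if insub (i : nat) is Some i' then E i' else fset0); split.
    + move=> i j ij x y; case: insubP => [i' _ ii'|]; last by rewrite inE.
      by case: insubP => [j' _ jj'|]; [apply: EE; rewrite ii' jj'|rewrite inE].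
    + by move=> i; case: insubP => [i' _ _|_]; [exact: bE|exact: schreier_set0].
    + have rs1 : (r.+1 <= (k s).+1)%N by [].
      move=> i /cE[l il]; exists (widen_ord rs1 l).
      by rewrite /= insubT ?ltn_ord// => ls; rewrite (_ : Sub _ _ = l)//; apply: val_inj.
  (* The maximum with 1 puts [k s] itself into the set, which bounds the number of blocks. *)
  exists (maxn 1 (n - s)); rewrite (schreierS hS ba) => -[r [E [rE EE bE AE]]].
  have [i0 ks] : exists i, k s \in E i.
    by apply/AE; apply/imfsetP; exists s => //=; rewrite mem_iota leqnn/= -{1}[s]addn0 ltn_add2l leq_max.
  apply: (ncle r); first exact: rE ks.
  exists E; split=> // i sin; apply/AE; apply/imfsetP; exists i => //=.
  by rewrite mem_iota; lia.
- have [n Sn] := choice (fun j => IH j s).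
  pose N := (\max_(j < (k s).+1) n j)%N.
  exists (maxn 1 N); rewrite (schreierL hS)// => -[j jA SA].
  have js : (j <= k s)%N.
    by apply: jA; apply/imfsetP; exists s => //=; rewrite mem_iota; lia.
  apply: (Sn j); apply: schreier_sub SA _; apply/fsubsetP => _ /imfsetP[i /= + ->].
  rewrite mem_iota => iI; apply/imfsetP; exists i => //=; rewrite mem_iota.
  have : (n j <= N)%N by exact: (@leq_bigmax _ (fun j : 'I_(k s).+1 => n j) (Ordinal (js : (j < (k s).+1)%N))).
  lia.
Qed.

(** By spreading: [phi] sends each element beyond [x] to its predecessor in [B] and fixes the
    others, so that the place of [x], vacant in [A], makes room for [k]. *)
Lemma schreier_rcons (a : W) (A B : {fset nat}) (x k : nat) :
  {in A, forall i, (i < k)%N} -> S a B -> A `<=` B -> x \in B -> x \notin A ->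
  (x <= k)%N -> S a (k |` A).
Proof.
move=> Ak SB AB xB xA xk.
have /choice[pr prP] : forall b, exists c, (x < b)%N ->
    [/\ c \in B, (c < b)%N & {in B, forall c', (c' < b)%N -> (c' <= c)%N}].
  move=> b; have [xb|] := boolP (x < b)%N; last by exists 0%N.
  have ex : exists c, (c \in B) && (c < b)%N by exists x; rewrite xB.
  have ub : forall c, (c \in B) && (c < b)%N -> (c <= b)%N by move=> c /andP[_ /ltnW].
  case: (ex_maxnP ex ub) => c /andP[cB cb] cmax; exists c => _; split=> // c' c'B c'b.
  by apply: cmax; rewrite c'B.
pose phi b := if (x < b)%N then pr b else b.
have inA y z : y \in k |` A -> z \in k |` A -> (y < z)%N -> y \in A.
  rewrite !inE => /orP[/eqP->|//] /orP[/eqP->|/Ak zk]; first by rewrite ltnn.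
  by move/(ltn_trans zk); rewrite ltnn.
have phim : {in k |` A &, {homo phi : y z / (y < z)%N}}.
  move=> y z yA zA yz; have yA' := inA _ _ yA zA yz.
  have yB : y \in B by apply: (fsubsetP AB).
  rewrite /phi; case: ifPn => xy; case: ifPn => xz.
  - have [_ pry _] := prP _ xy; have [_ _ /(_ _ yB yz)] := prP _ xz.
    exact: leq_trans.
  - by move: xz; rewrite (ltn_trans xy yz).
  - have [_ _ /(_ _ xB xz)] := prP _ xz; apply: leq_trans.
    move: xy; rewrite -leqNgt leq_eqVlt => /orP[/eqP yx|//].
    by rewrite -yx yA' in xA.
  - exact: yz.
apply: (schreier_dom (phi := phi) SB) => [b|].
  rewrite /phi => bA; case: ifPn => xb.
    by have [? /ltnW ? _] := prP _ xb.
  split=> //; move: bA; rewrite !inE => /orP[/eqP bk|/(fsubsetP AB)//].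
  suff -> : b = x by [].
  by apply/eqP; rewrite eqn_leq leqNgt xb/= bk xk.
move=> y z yA zA; have [yz|zy|->] := ltngtP y z; last by rewrite ltnn.
  by rewrite phim.
by apply/negbTE; rewrite -leqNgt ltnW// phim.
Qed.

Definition maximal_in (F : set {fset nat}) (A : {fset nat}) :=
  F A /\ forall B, F B -> A `<=` B -> B = A.

(** Greedy extension: as long as the set is not maximal, [schreier_rcons] allows any point far
    enough to the right, in particular one that preserves [P]; [schreier_no_chain] stops the
    process. *)
Lemma schreier_extend (a : W) (P : {fset nat} -> Prop) (A : {fset nat}) :
  S a A -> P A ->
  (forall B n, P B -> exists k,
    [/\ (n <= k)%N, {in B, forall i, (i < k)%N} & P (k |` B)]) ->
  exists B, [/\ A `<=` B, P B & maximal_in (S a) B].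
Proof.
move=> SA PA Pext; apply: contrapT => nB.
have /choice[k kP] : forall B, exists k, A `<=` B -> P B -> S a B ->
    [/\ {in B, forall i, (i < k)%N}, P (k |` B) & S a (k |` B)].
  move=> B; have [[AB PB SB]|nh] := pselect [/\ A `<=` B, P B & S a B]; last first.
    by exists 0%N => *; exfalso; apply: nh.
  have [C [SC BC [x xC xB]]] : exists C, [/\ S a C, B `<=` C & exists2 x, x \in C & x \notin B].
    apply: contrapT => nC; apply: nB; exists B; split=> //; split=> // C SC BC.
    apply/eqP; rewrite eqEfsubset BC andbT; apply/fsubsetP => x xC.
    by apply: contrapT => /negP xB; apply: nC; exists C; split=> //; exists x.
  have [k [xk Bk Pk]] := Pext B x PB; exists k => _ _ _; split=> //.
  exact: schreier_rcons xC xB xk.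
pose B n := iter n (fun B => k B |` B) A.
have BP n : [/\ A `<=` B n, P (B n) & S a (B n)].
  elim: n => [|n [AB PB SB]]; first by split.
  have [_ Pk Sk] := kP _ AB PB SB; split=> //.
  by apply: (fsubset_trans AB); exact: fsubsetUr.
have Bk m n : (m < n)%N -> k (B m) \in B n.
  elim: n => // n IH; rewrite ltnS leq_eqVlt /= !inE => /orP[/eqP->|/IH->].
    by rewrite eqxx.
  by rewrite orbT.
have kincr : {homo (fun n => k (B n)) : m n / (m < n)%N}.
  by move=> m n /Bk; have [AB PB SB] := BP n; have [+ _ _] := kP _ AB PB SB; apply.
have [n] := schreier_no_chain a kincr; apply.
have [_ _ SB] := BP n; apply: schreier_sub SB _.
by apply/fsubsetP => _ /imfsetP[i /= + ->]; rewrite mem_iota => /Bk.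
Qed.

End Family.

(** The interface that keeps ordinals out of the geometry. [slike_chain] provides compactness,
    [slike0] splits off the line of [e_0], and [slike_dom_rcons] excludes nontrivial
    permutations. *)
Record schreier_like (F : set {fset nat}) : Prop := SchreierLike {
  slike_sub : forall A B, F A -> B `<=` A -> F B;
  slike1 : forall i, F [fset i];
  slike2 : forall i j, (0 < i)%N -> (0 < j)%N -> F [fset i; j];
  slike0 : forall A, F A -> 0%N \in A -> A = [fset 0%N];
  slike_chain : forall k : nat -> nat, {homo k : m n / (m < n)%N} ->
    exists n, ~ F [fset k i | i in iota 0 n];
  slike_extend : forall (P : {fset nat} -> Prop) A, F A -> P A ->
    (forall B n, P B -> exists k,
      [/\ (n <= k)%N, {in B, forall i, (i < k)%N} & P (k |` B)]) ->
    exists B, [/\ A `<=` B, P B & maximal_in F B];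
  slike_dom_rcons : forall A B (phi : nat -> nat) (b0 k : nat), F A ->
    {in B, forall b, phi b \in A /\ (phi b <= b)%N} ->
    {in B &, {mono phi : x y / (x < y)%N}} ->
    b0 \in B -> {in B, forall b, (b0 <= b)%N} -> (phi b0 < b0)%N ->
    {in B, forall b, (b < k)%N} -> F (k |` B)
}.

Lemma schreier_schreier_like (d : Order.disp_t) (W : orderType d) appr
    (S : W -> set {fset nat}) (a : W) :
  well_founded (fun a b : W => (a < b)%O) -> transfinite_schreier appr S ->
  ~ ord_zero a -> schreier_like (S a).
Proof.
move=> Wwf hS a0; split.
- by move=> A B; exact: (schreier_sub Wwf hS).
- exact: (schreier1 Wwf hS).
- by move=> i j; exact: (schreier2 Wwf hS).
- exact: (schreier_min0 Wwf hS).
- exact: (schreier_no_chain Wwf hS).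
- exact: (schreier_extend Wwf hS).
- by move=> A B phi b0 k; exact: (schreier_dom_rcons Wwf hS).
Qed.

(** * The Mazur-Ulam argument in the unit ball *)

Section BallMazurUlam.
Context {R : realType} {X : normedModType R}.

Record bij_isometry (A B : set X) (f f' : X -> X) : Prop := BijIsometry {
  bij_isom_fun : forall x, A x -> B (f x);
  bij_isom_fun' : forall x, B x -> A (f' x);
  bij_isomK : forall x, A x -> f' (f x) = x;
  bij_isomK' : forall x, B x -> f (f' x) = x;
  bij_isom_dist : isometry_on A f
}.

Lemma bij_isometry_sym (A B : set X) f f' : bij_isometry A B f f' -> bij_isometry B A f' f.
Proof.
move=> [fAB fBA fK fK' fd]; split=> // x y Bx By.
by rewrite -fd ?fK'//; exact: fBA.
Qed.

Lemma bij_isometry_comp (A B C : set X) f f' g g' :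
  bij_isometry A B f f' -> bij_isometry B C g g' ->
  bij_isometry A C (g \o f) (f' \o g').
Proof.
move=> [fAB fBA fK fK' fd] [gAB gBA gK gK' gd]; split=> /=.
- by move=> x /fAB/gAB.
- by move=> x /gBA/fBA.
- by move=> x Ax; rewrite gK ?fK//; exact: fAB.
- by move=> x Ax; rewrite fK' ?gK'//; exact: gBA.
- by move=> x y Ax Ay /=; rewrite gd ?fd//; exact: fAB.
Qed.

Lemma bij_isometry_reflect (A : set X) z :
  (forall x, A x -> A (z + z - x)) ->
  bij_isometry A A (fun x => z + z - x) (fun x => z + z - x).
Proof.
move=> Az; split=> //; try by move=> x _; rewrite opprB addrC subrK.
by move=> x y _ _; rewrite opprB addrC addrA subrK distrC.
Qed.

(** Doubling argument of Väisälä: if rho is the reflection in [z], then the isometry rho h' rho h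
    moves [z] twice as far as [h] does, while all displacements of [z] are bounded by [M]. *)
Lemma bij_isometry_center (A : set X) z M h h' :
  A z -> (forall x, A x -> A (z + z - x)) -> (forall x, A x -> `|x - z| <= M) ->
  bij_isometry A A h h' -> h z = z.
Proof.
move=> Az Ar AM hA.
have bnd n : forall h h', bij_isometry A A h h' -> `|h z - z| *+ (2 ^ n) <= M.
  elim: n => [|n IH] {hA}h {}h' hA; first by apply: AM; exact: (bij_isom_fun hA).
  have rA := bij_isometry_reflect Ar.
  have := IH _ _ (bij_isometry_comp (bij_isometry_comp hA rA)
    (bij_isometry_comp (bij_isometry_sym hA) rA)).
  apply: le_trans => /=; rewrite expnS mulrnA lerMn2r; apply/orP; right.
  have -> : z + z - h' (z + z - h z) - z = z - h' (z + z - h z).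
    by rewrite addrAC addrK.
  have Ahz := bij_isom_fun hA Az.
  rewrite -{3}(bij_isomK hA Az) (bij_isom_dist (bij_isometry_sym hA))//; last exact: Ar.
  have -> : h z - (z + z - h z) = (h z - z) *+ 2.
    by rewrite mulr2n opprB addrCA [RHS]addrACA -opprD addrA.
  by rewrite normrMn.
apply/eqP; rewrite -subr_eq0 -normr_le0 leNgt; apply/negP => hz.
have := bnd (Num.truncn (M / `|h z - z|)).+1 _ _ hA.
apply/negP; rewrite -ltNge -mulr_natr -ltr_pdivrMl// mulrC.
apply: (lt_le_trans (truncnS_gt _)).
by rewrite ler_nat ltnW// ltn_expl.
Qed.

Definition unit_ball : set X := [set x | `|x| <= 1].

Context (f f' : X -> X) (fB : bij_isometry unit_ball unit_ball f f') (f0 : f 0 = 0).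

Lemma ball_isometry_norm x : `|x| <= 1 -> `|f x| = `|x|.
Proof.
move=> x1; rewrite -[f x]subr0 -f0 (bij_isom_dist fB) ?subr0//=.
by rewrite /unit_ball/= normr0.
Qed.

(** The set [H a b] of metric midpoints is symmetric about the algebraic midpoint, and [f] carries
    it onto [H (f a) (f b)]. The hypothesis on the norms keeps both sets in the ball. Composing [f],
    its inverse and the two reflections gives an isometry of [H a b], which fixes the centre. *)
Lemma ball_isometry_midpoint a b : `|b| <= 1 -> `|a| + `|a - b| / 2 <= 1 ->
  f (2^-1 *: (a + b)) = 2^-1 *: (f a + f b).
Proof.
move=> b1 ab.
have a1 : `|a| <= 1 by apply: le_trans ab; rewrite lerDl divr_ge0.
pose H (u v : X) : set X := [set x | `|x - u| = `|u - v| / 2 /\ `|x - v| = `|u - v| / 2].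
have Hsub u v : `|u| + `|u - v| / 2 <= 1 -> (H u v `<=` unit_ball)%classic.
  move=> uv x [xu _]; rewrite /unit_ball/=.
  by apply: le_trans uv; rewrite -xu -{1}[x](subrK u) addrC ler_normD.
have mid (u v : X) : 2^-1 *: (u + v) + 2^-1 *: (u + v) = u + v.
  by rewrite -scalerDl -[2^-1](mul1r) -splitr scale1r.
have dmid (u v : X) : 2^-1 *: (u + v) - u = 2^-1 *: (v - u).
  rewrite -{2}(scale1r u) [X in X *: u](splitr 1) div1r scalerDl opprD addrA.
  by rewrite -scalerBr [u + v]addrC addrK -scalerBr.
have Hz u v : H u v (2^-1 *: (u + v)).
  split; first by rewrite dmid normrZ ger0_norm ?invr_ge0// distrC mulrC.
  by rewrite [u + v]addrC dmid normrZ ger0_norm ?invr_ge0// mulrC.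
have Hr u v x : H u v x -> H u v (2^-1 *: (u + v) + 2^-1 *: (u + v) - x).
  rewrite /H/= mid => -[xu xv]; split.
    by rewrite addrAC [u + v]addrC addrK distrC.
  by rewrite addrAC addrK distrC.
have fab : `|f a - f b| = `|a - b| by rewrite (bij_isom_dist fB).
have Hfab : (H (f a) (f b) `<=` unit_ball)%classic.
  by apply: Hsub; rewrite fab ball_isometry_norm.
have fH : bij_isometry (H a b) (H (f a) (f b)) f f'.
  have Hab := Hsub _ _ ab.
  split.
  - move=> x Hx; have xB := Hab _ Hx; case: Hx => xa xb.
    by split; rewrite fab (bij_isom_dist fB).
  - move=> x Hx; have xB := Hfab _ Hx; case: Hx => xa xb.
    have f'B := bij_isom_dist (bij_isometry_sym fB).
    have f'd u : unit_ball u -> `|f' x - u| = `|x - f u|.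
      by move=> uB; rewrite -{1}(bij_isomK fB uB) f'B//; exact: (bij_isom_fun fB).
    by split; rewrite f'd// -fab.
  - by move=> x /Hab /(bij_isomK fB).
  - by move=> x /Hfab /(bij_isomK' fB).
  - by move=> x y /Hab xB /Hab yB; exact: (bij_isom_dist fB).
have bnd x : H a b x -> `|x - 2^-1 *: (a + b)| <= `|a - b|.
  move=> [xa _]; rewrite -(subrK a x) -addrA; apply: (le_trans (ler_normD _ _)).
  rewrite xa [X in _ + X]distrC dmid normrZ ger0_norm ?invr_ge0//.
  by rewrite (distrC b a) [2^-1 * _]mulrC -splitr.
have := bij_isometry_center (Hz a b) (@Hr a b) bnd
  (bij_isometry_comp (bij_isometry_comp fH (bij_isometry_reflect (@Hr (f a) (f b))))
    (bij_isometry_comp (bij_isometry_sym fH) (bij_isometry_reflect (@Hr a b)))).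
rewrite /=.
set z := 2^-1 *: (a + b); set w := 2^-1 *: (f a + f b) => /eqP.
rewrite subr_eq => /eqP/addrI => f'z.
have Hfz : H (f a) (f b) (f z) by apply: (bij_isom_fun fH); exact: Hz.
have := congr1 f f'z; rewrite (bij_isomK' fB); last by apply: Hfab; exact: Hr.
move=> /eqP; rewrite eq_sym subr_eq -[w + w]mulr2n -[f z + f z]mulr2n.
rewrite -(scaler_nat 2 w) -(scaler_nat 2 (f z)).
by rewrite (inj_eq (scalerI _)) ?pnatr_eq0// => /eqP.
Qed.

Lemma ball_isometry_half x : `|x| <= 1 -> f (2^-1 *: x) = 2^-1 *: f x.
Proof.
move=> x1; have := @ball_isometry_midpoint 0 x x1.
rewrite sub0r normrN normr0 f0 !add0r; apply.
by rewrite ler_pdivrMr// mul1r (le_trans x1)// ler1n.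
Qed.

Lemma ball_isometryD a b : `|a| <= 2^-1 -> `|b| <= 2^-1 -> f (a + b) = f a + f b.
Proof.
move=> a2 b2.
have half1 : (2^-1 : R) <= 1 by rewrite invf_le1// ler1n.
have half2 : (2^-1 + 2^-1 : R) = 1 by rewrite -[2^-1]mul1r -splitr.
have ab1 : `|a + b| <= 1 by rewrite (le_trans (ler_normD _ _))// -half2 lerD.
have : 2^-1 *: f (a + b) = 2^-1 *: (f a + f b).
  rewrite -ball_isometry_half// ball_isometry_midpoint ?(le_trans b2)//.
  have := ler_normB a b; lra.
by apply: scalerI; rewrite invr_eq0.
Qed.

(** Additivity is known on the half ball only, whence the reduction to it. There [f] respects
    integer multiples, and [t] is approximated by fractions [k / N]. *)
Lemma ball_isometryZ t x : 0 <= t <= 1 -> `|x| <= 1 -> f (t *: x) = t *: f x.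
Proof.
wlog x2 : x / `|x| <= 2^-1 => [wl|].
  move=> t01 x1; have tx1 : `|t *: x| <= 1.
    by rewrite normrZ mulr_ile1//; case/andP: t01 => ? ?; rewrite ger0_norm.
  apply: (@scalerI _ _ (2^-1)); first by rewrite invr_eq0.
  rewrite -ball_isometry_half// scalerA mulrC -!scalerA wl//.
  - by rewrite ball_isometry_half// !scalerA mulrC.
  - by rewrite normrZ ger0_norm ?invr_ge0// ler_piMr ?invr_ge0.
  - by rewrite normrZ ger0_norm ?invr_ge0// mulr_ile1 ?invr_ge0// invf_le1 ?ler1n.
move=> /andP[t0 t1] x1.
have fnat n y : `|y| *+ n <= 2^-1 -> f (y *+ n) = f y *+ n.
  elim: n => [|n IH] yn; first by rewrite !mulr0n.
  have yn' : `|y| *+ n <= 2^-1.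
    by apply: le_trans yn; rewrite mulrS lerDr.
  rewrite !mulrS ball_isometryD ?IH//; last by rewrite normrMn.
  by apply: le_trans yn; rewrite mulrS lerDl mulrn_wge0.
apply/eqP; rewrite -subr_eq0 -normr_le0; apply/ler_addgt0Pl => e e0.
rewrite addr0.
(* Two errors of at most [1 / N] each have to fit into [e]. *)
pose N := (Num.truncn (2 / e)).+1; pose k := Num.truncn (t * N%:R).
have N0 : 0 < N%:R :> R by rewrite ltr0n.
have /andP[kt tk] : (k%:R <= t * N%:R < k.+1%:R).
  by apply: truncn_itv; rewrite mulr_ge0// ltW.
have kN : (k <= N)%N.
  by rewrite -(ler_nat R) (le_trans kt)// ler_piMl// ltW.
pose y := N%:R^-1 *: x.
have yE : `|y| *+ N = `|x|.
  by rewrite normrZ ger0_norm ?invr_ge0// -[LHS]mulr_natl mulrA mulfV ?mul1r ?gt_eqF.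
have xE : x = y *+ N by rewrite -scaler_nat scalerA mulfV ?gt_eqF// scale1r.
have yk : `|y| *+ k <= `|x|.
  by rewrite -yE -[leLHS]mulr_natr -[leRHS]mulr_natr ler_wpM2l// ler_nat.
have fk : f (y *+ k) = f y *+ k.
  by apply: fnat; apply: le_trans x2.
have fN : f x = f y *+ N by rewrite {1}xE fnat// yE.
have y1 : `|y| <= 1.
  rewrite normrZ ger0_norm ?invr_ge0// mulr_ile1 ?invr_ge0// invf_le1//.
  by rewrite ler1n.
have dk : `|t *: x - y *+ k| <= N%:R^-1.
  rewrite -scaler_nat scalerA -scalerBl normrZ.
  rewrite -[leRHS]mulr1 ler_pM// ger0_norm ?subr_ge0 ?ler_pdivrMr//.
  rewrite -(ler_pM2r N0) mulrBl mulfVK ?gt_eqF// mulVf ?gt_eqF//.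
  by rewrite -natr1 in tk; lra.
rewrite -(subrK (f (y *+ k)) (f (t *: x))) -addrA.
apply: (le_trans (ler_normD _ _)).
rewrite (bij_isom_dist fB); last 2 first.
- by rewrite /unit_ball/= normrZ mulr_ile1// ger0_norm.
- rewrite /unit_ball/= normrMn;
  exact: le_trans x1.
have -> : `|f (y *+ k) - t *: f x| = `|t *: x - y *+ k|.
  rewrite fk fN {1}xE -!(scaler_nat _ y) -!(scaler_nat _ (f y)) !scalerA -!scalerBl !normrZ distrC.
  by rewrite ball_isometry_norm// normrZ mulrA.
apply: (le_trans (lerD dk dk)).
have /ltW : 2 / e < N%:R by exact: truncnS_gt.
rewrite ler_pdivrMr// => Ne; rewrite -(ler_pM2r N0) mulrDl mulVf ?gt_eqF//; lra.
Qed.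

Lemma ball_isometry_linear :
  exists g : {linear X -> X}, (forall x, `|x| <= 1 -> g x = f x) /\
    forall x, `|g x| = `|x|.
Proof.
(* The summand 1 keeps the factor positive at 0; by [gE] below, every positive factor not less than
   the norm of [x] gives the same value. *)
pose g x := (`|x| + 1) *: f ((`|x| + 1)^-1 *: x).
have pos (x : X) : 0 < `|x| + 1 :> R by rewrite ltr_wpDl.
have ball (r : R) (x : X) : 0 < r -> `|x| <= r -> `|r^-1 *: x| <= 1.
  by move=> r0 xr; rewrite normrZ gtr0_norm ?invr_gt0// mulrC ler_pdivrMr// mul1r.
have scale (r s : R) (x : X) : 0 < r -> r <= s -> `|x| <= r ->
    r *: f (r^-1 *: x) = s *: f (s^-1 *: x).
  move=> r0 rs xr; have s0 : 0 < s by exact: lt_le_trans rs.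
  have -> : s^-1 *: x = (r / s) *: (r^-1 *: x).
    by rewrite scalerA mulrAC mulfV ?gt_eqF// mul1r.
  rewrite (ball_isometryZ (t := r / s)) ?ball//; last first.
    by apply/andP; split; [rewrite divr_ge0// ltW|rewrite ler_pdivrMr// mul1r].
  by rewrite scalerA mulrC mulfVK// gt_eqF.
have gE (r : R) (x : X) : 0 < r -> `|x| <= r -> g x = r *: f (r^-1 *: x).
  move=> r0 xr; have [rs|/ltW sr] := leP r (`|x| + 1).
    by rewrite (scale r _ x r0 rs xr).
  by rewrite -(scale (`|x| + 1))// lerDl.
have gf (x : X) : `|x| <= 1 -> g x = f x.
  by move=> x1; rewrite (gE 1)// invr1 !scale1r.
have gD : {morph g : x y / x + y}.
  move=> x y; pose r := (`|x| + `|y|) *+ 2 + 1.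
  have r0 : 0 < r by rewrite ltr_wpDl// mulrn_wge0// addr_ge0.
  have half (z : X) : `|z| <= `|x| + `|y| -> `|r^-1 *: z| <= 2^-1.
    move=> zxy; rewrite normrZ gtr0_norm ?invr_gt0// mulrC ler_pdivrMr//.
    rewrite -ler_pdivrMl ?invr_gt0// invrK mulr_natl.
    by rewrite /r; lra.
  have xle : `|x| <= `|x| + `|y| by rewrite lerDl.
  have yle : `|y| <= `|x| + `|y| by rewrite lerDr.
  have big (z : X) : `|z| <= `|x| + `|y| -> `|z| <= r.
    by move=> zle; rewrite (le_trans zle)// /r mulr2n -addrA lerDl addr_ge0// addr_ge0.
  rewrite !(gE r) ?big ?ler_normD// scalerDr ball_isometryD ?scalerDr//; exact: half.
have g0 : g 0 = 0 by rewrite gf ?normr0.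
have gN (x : X) : g (- x) = - g x.
  by apply/eqP; rewrite -addr_eq0 -gD addNr g0.
have gZ1 (t : R) (x : X) : 0 <= t <= 1 -> g (t *: x) = t *: g x.
  move=> t01; have tx : `|t *: x| <= `|x| + 1.
    case/andP: t01 => t0 t1; rewrite normrZ ger0_norm// (le_trans (ler_piMl _ t1))//.
    by rewrite lerDl.
  rewrite (gE (`|x| + 1))// scalerA [_^-1 * _]mulrC -scalerA ball_isometryZ//.
    by rewrite /g !scalerA mulrC.
  by apply: ball => //; rewrite lerDl.
have gZ0 (t : R) (x : X) : 0 <= t -> g (t *: x) = t *: g x.
  move=> t0; have [t1|/ltW t1] := leP t 1; first by rewrite gZ1// t0.
  have tp : 0 < t by exact: lt_le_trans t1.
  have /(_ (t *: x)) := @gZ1 t^-1.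
  rewrite scalerA mulVf ?gt_eqF// scale1r => -> //.
    by rewrite scalerA mulfV ?gt_eqF// scale1r.
  by rewrite invr_ge0 t0 invf_le1.
have glin : linear g.
  move=> t x y; rewrite gD; congr (_ + _).
  have [t0|/ltW t0] := leP 0 t; first exact: gZ0.
  by rewrite -[t in LHS]opprK scaleNr gN gZ0 ?oppr_ge0// scaleNr opprK.
exists (HB.pack_for {linear X -> X} g (GRing.isLinear.Build R X X *:%R g glin)).
split=> // x /=; rewrite normrZ gtr0_norm// ball_isometry_norm.
  by rewrite normrZ gtr0_norm ?invr_gt0// mulrA mulfV ?gt_eqF// mul1r.
by apply: ball => //; rewrite lerDl.
Qed.

End BallMazurUlam.

(** * Convexity of powers and sums of powers *)

Section PowerSums.
Context {R : realType}.
Implicit Types (p v h : R) (x y : nat -> R) (A B : {fset nat}).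

(** Write v^p = v v^(p-1) >= v (1 + (p - 1) ln v) and use the strict inequality v ln v > v - 1. *)
Lemma powR_bernoulli p v : 1 < p -> 0 <= v -> v != 1 -> 1 + p * (v - 1) < v `^ p.
Proof.
move=> p1 v0 v1; have [->|vn0] := eqVneq v 0.
  by rewrite powR0; [lra|rewrite gt_eqF//; lra].
have {v0}v0 : 0 < v by rewrite lt_def vn0.
have vE : expR (ln v) = v by rewrite lnK.
have lnv0 : ln v != 0 by rewrite ln_eq0.
have : 1 - ln v < expR (- ln v) by rewrite expR_gt1Dx// oppr_eq0.
rewrite expRN vE -(ltr_pM2r v0) mulVf// => lt1.
have le2 : v * (1 + (p - 1) * ln v) <= v `^ p.
  rewrite -(mulr_powRB1 (ltW v0) (lt_trans ltr01 p1)).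
  by rewrite ler_pM2l// /powR (negbTE vn0) expR_ge1Dx.
apply: lt_le_trans le2; nra.
Qed.

Lemma powR_bernoulli_le p v : 1 < p -> 0 <= v -> 1 + p * (v - 1) <= v `^ p.
Proof.
move=> p1 v0; have [->|v1] := eqVneq v 1; first by rewrite powR1 subrr mulr0 addr0.
exact/ltW/powR_bernoulli.
Qed.

(** Strict convexity: after division by |v|, Bernoulli applies to the two ratios, whose sum is at
    least 2. It is strict unless both ratios are 1, which forces [h] or [v] to vanish. *)
Lemma powR_midpoint p v h : 1 < p -> h != 0 ->
  2 * `|v| `^ p < `|v + h| `^ p + `|v - h| `^ p.
Proof.
move=> p1 h0; have p0 : 0 < p by apply: lt_trans p1.
have [->|v0] := eqVneq v 0.
  rewrite normr0 powR0 ?gt_eqF// mulr0 add0r sub0r normrN.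
  by rewrite addr_gt0// powR_gt0// normr_gt0.
have m0 : 0 < `|v| by rewrite normr_gt0.
pose a := `|v + h| / `|v|; pose b := `|v - h| / `|v|.
have a0 : 0 <= a by rewrite divr_ge0.
have b0 : 0 <= b by rewrite divr_ge0.
have aE : `|v + h| = a * `|v| by rewrite divfK// gt_eqF.
have bE : `|v - h| = b * `|v| by rewrite divfK// gt_eqF.
clearbody a b.
rewrite aE bE !powRM// -mulrDl ltr_pM2r ?powR_gt0//.
have ab2 : 2 <= a + b.
  rewrite -(ler_pM2r m0) [leRHS]mulrDl -aE -bE.
  by have := ler_normD (v + h) (v - h); rewrite addrACA subrr addr0 -mulr2n normrMn; lra.
have pab : 0 <= p * (a + b - 2) by rewrite mulr_ge0 ?subr_ge0// ltW.
have [a1|a1] := eqVneq a 1; last first.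
  have := powR_bernoulli p1 a0 a1; have := powR_bernoulli_le p1 b0; lra.
have [b1|b1] := eqVneq b 1; last first.
  have := powR_bernoulli p1 b0 b1; have := powR_bernoulli_le p1 a0; lra.
exfalso; move: aE bE; rewrite a1 b1 !mul1r => /eqP + /eqP.
rewrite !eqr_norm2 => /orP[]/eqP vh1 /orP[]/eqP vh2.
- by move/eqP: h0; apply; lra.
- by move/eqP: h0; apply; lra.
- by move/eqP: h0; apply; lra.
- by move/eqP: v0; apply; lra.
Qed.

Lemma powR_midpoint_le p v h : 1 <= p ->
  2 * `|v| `^ p <= `|v + h| `^ p + `|v - h| `^ p.
Proof.
move=> p1; have [->|h0] := eqVneq h 0; first by rewrite addr0 subr0; lra.
have [p1'|] := ltP 1 p; first exact/ltW/powR_midpoint.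
move=> p1'; have -> : p = 1 by apply/eqP; rewrite eq_le p1 p1'.
rewrite !powRr1//; have := ler_normD (v + h) (v - h).
by rewrite addrACA subrr addr0 -mulr2n normrMn; lra.
Qed.

Definition psum p x A := \sum_(i <- A) `|x i| `^ p.

Lemma psum_ge0 p x A : 0 <= psum p x A.
Proof. by apply: sumr_ge0 => i _; exact: powR_ge0. Qed.

Lemma psum_le p x y A : 0 <= p -> {in A, forall i, `|x i| <= `|y i|} ->
  psum p x A <= psum p y A.
Proof.
move=> p0 xy; rewrite /psum big_seq [leRHS]big_seq; apply: ler_sum => i iA.
by apply: ge0_ler_powR; rewrite ?nnegrE// xy.
Qed.

Lemma psum_eq p x y A : {in A, forall i, `|x i| = `|y i|} -> psum p x A = psum p y A.
Proof. by move=> xy; apply: eq_big_seq => i iA; rewrite xy. Qed.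

Lemma psum0 p x A : p != 0 -> {in A, forall i, x i = 0} -> psum p x A = 0.
Proof.
move=> p0 x0; rewrite /psum big_seq big1// => i iA.
by rewrite x0// normr0 powR0.
Qed.

Lemma psum_fset0 p x : psum p x fset0 = 0.
Proof. by rewrite /psum big_seq_fset0. Qed.

Lemma psum1 p x i : psum p x [fset i] = `|x i| `^ p.
Proof. by rewrite /psum big_seq_fset1. Qed.

Lemma psumD1 p x A i : i \in A -> psum p x A = `|x i| `^ p + psum p x (A `\ i).
Proof. by move=> iA; rewrite /psum (big_fsetD1 i). Qed.

Lemma psum_sub p x A B : A `<=` B -> psum p x A <= psum p x B.
Proof.
move=> AB; rewrite /psum (big_fsetID _ (fun i => i \in A) B)/=.
rewrite (_ : [fset i | i in B & i \in A] = A).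
  by rewrite lerDl sumr_ge0// => i _; exact: powR_ge0.
apply/fsetP => i; rewrite !inE; apply/andP/idP => [[]//|iA]; split=> //.
exact: (fsubsetP AB).
Qed.

Lemma psum_supp p x A B : p != 0 -> A `<=` B ->
  (forall i, i \in B -> i \notin A -> x i = 0) -> psum p x A = psum p x B.
Proof.
move=> p0 AB xA; apply: big_fset_incl => // i iB iA.
by rewrite xA// normr0 powR0.
Qed.

Lemma psum_supp_le p x A B : p != 0 -> {in A, forall i, x i != 0 -> i \in B} ->
  psum p x A <= psum p x B.
Proof.
move=> p0 AB; rewrite -(@psum_supp p x (A `&` B))// ?fsubsetIl//; last first.
  move=> i iA; rewrite !inE iA/= => iB; apply/eqP; apply: contraNT iB; exact: AB.
by apply: psum_sub; exact: fsubsetIr.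
Qed.

Lemma psumD p x y A : p != 0 -> {in A, forall i, x i = 0 \/ y i = 0} ->
  psum p (x \+ y) A = psum p x A + psum p y A.
Proof.
move=> p0 xy; rewrite /psum -big_split; apply: eq_big_seq => i iA /=.
by have [->|->] := xy i iA; rewrite normr0 powR0// ?add0r ?addr0.
Qed.

Lemma psumZ p a x A : psum p (fun i => a * x i) A = `|a| `^ p * psum p x A.
Proof. by rewrite /psum mulr_sumr; apply: eq_bigr => i _; rewrite normrM powRM. Qed.

Lemma powR_invK p v : 0 < p -> 0 <= v -> (v `^ p^-1) `^ p = v.
Proof. by move=> p0 v0; rewrite -powRrM mulVf ?gt_eqF// powRr1. Qed.

Lemma powRK_inv p v : 0 < p -> 0 <= v -> (v `^ p) `^ p^-1 = v.
Proof. by move=> p0 v0; rewrite -powRrM mulfV ?gt_eqF// powRr1. Qed.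

Lemma ler_powR2 p v h : 0 < p -> 0 <= v -> 0 <= h -> (v `^ p <= h `^ p) = (v <= h).
Proof.
move=> p0 v0 h0; apply/idP/idP; last by apply: ge0_ler_powR; rewrite ?nnegrE// ltW.
by apply: contraTT; rewrite -!ltNge; apply: gt0_ltr_powR; rewrite ?nnegrE.
Qed.

Lemma ltr_powR2 p v h : 0 < p -> 0 <= v -> 0 <= h -> (v `^ p < h `^ p) = (v < h).
Proof. by move=> p0 v0 h0; rewrite !ltNge ler_powR2. Qed.

End PowerSums.

(** * The Schreier space through its coordinates *)

Definition fin_sum {R : realType} {X : normedModType R} (e : nat -> X)
  (a : nat -> R) (A : {fset nat}) : X := \sum_(i <- A) a i *: e i.

(** An abstract model of the space: [normP] describes closed balls without suprema or roots, and
    [co_tail] encodes the density of the finitely supported vectors. *)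
Record schreier_space {R : realType} (F : set {fset nat}) (p : R)
    (X : normedModType R) (e : nat -> X) (co : X -> nat -> R) : Prop := SchreierSpace {
  coD : forall x y i, co (x + y) i = co x i + co y i;
  coZ : forall a x i, co (a *: x) i = a * co x i;
  co_e : forall i j, co (e i) j = (j == i)%:R;
  normP : forall x r, 0 <= r ->
    (`|x| <= r <-> forall A, F A -> psum p (co x) A <= r `^ p);
  co_tail : forall x r, 0 < r -> exists N, forall A, F A ->
    {in A, forall i, (N <= i)%N} -> psum p (co x) A <= r `^ p
}.

Section Coordinates.
Context {R : realType} (F : set {fset nat}) (hF : schreier_like F) (p : R) (hp : 1 <= p).
Context (X : completeNormedModType R) (iota : {linear c00 R -> X})
  (hX : is_completion F p iota).

Let p0 : 0 < p. Proof. exact: lt_le_trans hp. Qed.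
Let pn0 : p != 0. Proof. by rewrite gt_eqF. Qed.

Lemma c00_suppP (c : c00 R) : exists n, forall i, (n <= i)%N -> c i = 0.
Proof. by case: c => f /= /asboolP. Qed.

Lemma psum_le_iota (c : c00 R) A : F A -> psum p c A <= `|iota c| `^ p.
Proof.
move=> FA; rewrite -[leLHS](powR_invK p0 (psum_ge0 _ _ _)) (ler_powR2 p0) ?powR_ge0//.
rewrite hX.1; apply: ub_le_sup; last by exists A.
have [n cn] := c00_suppP c.
exists (psum p c [fset i | i in seq.iota 0 n] `^ p^-1) => _ [B FB <-].
have sum0 D : \sum_(i <- D) `|c i| `^ p \is Num.nneg.
  by apply: sumr_ge0 => i _; exact: powR_ge0.
apply: ge0_ler_powR => //; [by rewrite invr_ge0 ltW|exact: sum0|].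
apply: psum_supp_le => // i iB ci0; apply/imfsetP; exists i => //=.
rewrite mem_iota /=; apply: contraNT ci0; rewrite -leqNgt => /cn ->//.
Qed.

Lemma iota_le (c : c00 R) r : 0 <= r -> (forall A, F A -> psum p c A <= r `^ p) ->
  `|iota c| <= r.
Proof.
move=> r0 cr; rewrite hX.1; apply: ge_sup.
  by exists (psum p c [fset 0%N] `^ p^-1), [fset 0%N] => //; exact: slike1 hF _.
move=> _ [B FB <-]; rewrite -(powRK_inv p0 r0).
by apply: ge0_ler_powR; rewrite ?nnegrE ?powR_ge0 ?invr_ge0 ?(ltW p0)//; [exact: psum_ge0|exact: cr].
Qed.

Lemma iota_dense (x : X) r : 0 < r -> exists c, `|x - iota c| < r.
Proof.
move=> r0; have [_ dX] := hX.
have /= [||y [xy [c _ cy]]] := dX (ball x r).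
- by exists x; exact: ballxx.
- exact: ball_open.
- by exists c; rewrite cy; move: xy; rewrite -ball_normE.
Qed.

(* McShane extension to the completion of the i-th coordinate, which is
   1-Lipschitz on c00. *)
Definition coord (x : X) (i : nat) : R :=
  sup [set c i - `|x - iota c| | c in [set: c00 R]].

Lemma coordE (x : X) (c : c00 R) i : `|coord x i - c i| <= `|x - iota c|.
Proof.
have lip (c' c'' : c00 R) : c' i - c'' i <= `|iota c' - iota c''|.
  rewrite -raddfB; apply: le_trans (_ : `|(c' - c'') i| <= _); first exact: ler_norm.
  rewrite -(ler_powR2 p0)//; apply: le_trans (psum_le_iota _ (slike1 hF i)).
  by rewrite psum1.
have ub (c' : c00 R) : ubound [set c i - `|x - iota c| | c in [set: c00 R]] (c' i + `|x - iota c'|).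
  move=> _ [c'' _ <-]; have := lip c'' c'.
  have := ler_distD x (iota c'') (iota c'); rewrite (distrC (iota c'') x); lra.
have lb : c i - `|x - iota c| <= coord x i.
  by apply: ub_le_sup; [exists (c i + `|x - iota c|); exact: ub|exists c].
have : coord x i <= c i + `|x - iota c|.
  by apply: ge_sup; [exists (c i - `|x - iota c|), c|exact: ub].
rewrite ler_norml; lra.
Qed.

Lemma coord_eq (x : X) i r :
  (forall e, 0 < e -> exists2 c, `|x - iota c| < e & `|r - c i| < e) -> coord x i = r.
Proof.
move=> xr; apply/eqP; rewrite -subr_eq0 -normr_le0; apply/ler_addgt0Pl => e e0.
rewrite addr0; have [|c xc rc] := xr (e / 2); first by rewrite divr_gt0.
rewrite -(subrK (c i) (coord x i)) -addrA (le_trans (ler_normD _ _))//.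
rewrite [leRHS]splitr lerD// ?(le_trans (coordE _ _ _))//; first exact: ltW.
by rewrite distrC ltW.
Qed.

Lemma coordD x y i : coord (x + y) i = coord x i + coord y i.
Proof.
apply: coord_eq => e e0; have e20 : 0 < e / 2 by rewrite divr_gt0.
have [c xc] := iota_dense x e20; have [c' yc'] := iota_dense y e20.
exists (c + c'); first rewrite raddfD opprD addrACA (le_lt_trans (ler_normD _ _))//.
  by rewrite [ltRHS]splitr ltrD.
rewrite -[(c + c') i]/(c i + c' i) opprD addrACA (le_lt_trans (ler_normD _ _))//.
by rewrite [ltRHS]splitr ltrD// (le_lt_trans (coordE _ _ _)).
Qed.

Lemma coordZ a x i : coord (a *: x) i = a * coord x i.
Proof.
apply: coord_eq => e e0.
have ea : 0 < e / (`|a| + 1) by rewrite divr_gt0// ltr_wpDl.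
have [c xc] := iota_dense x ea.
have small r : 0 <= r -> r < e / (`|a| + 1) -> `|a| * r < e.
  move=> r0; rewrite ltr_pdivlMr ?ltr_wpDl// => re.
  by apply: le_lt_trans re; rewrite mulrC ler_wpM2l// lerDl.
exists (a *: c).
  by rewrite linearZ -scalerBr normrZ small.
rewrite -[(a *: c) i]/(a * c i) -mulrBr normrM small//.
exact: le_lt_trans (coordE _ _ _) _.
Qed.

Lemma coord_iota (c : c00 R) i : coord (iota c) i = c i.
Proof. by apply: coord_eq => e e0; exists c; rewrite subrr normr0. Qed.

Local Notation e := (fun i => iota (c00_basis R i)).

Local Notation fsum := (fin_sum e).

Lemma fsumB a b A : fsum a A - fsum b A = fsum (a \- b) A.
Proof. by rewrite -sumrB; apply: eq_bigr => i _; rewrite -scalerBl. Qed.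

Lemma fsum_c00 a A : exists2 c : c00 R, fsum a A = iota c &
  forall i, c i = if i \in A then a i else 0.
Proof.
exists (\sum_(i <- A) a i *: c00_basis R i).
  by rewrite linear_sum; apply: eq_bigr => i _; rewrite linearZ.
move=> i; have val_sum (s : seq nat) (f : nat -> c00 R) :
    (\sum_(j <- s) f j) i = \sum_(j <- s) f j i.
  by elim: s => [|j s IH]; rewrite ?big_nil// !big_cons -IH.
rewrite val_sum; case: ifPn => iA.
  rewrite (big_fsetD1 i)//= big_seq big1 ?addr0.
    by rewrite -[LHS]/(a i * (i == i)%:R) eqxx mulr1.
  move=> j; rewrite !inE => /andP[ji _].
  by rewrite -[LHS]/(a j * (i == j)%:R) eq_sym (negbTE ji) mulr0.
rewrite big_seq big1// => j jA; rewrite -[LHS]/(a j * (i == j)%:R).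
by case: eqP jA iA => [-> ->//|_ _ _]; rewrite mulr0.
Qed.

Lemma norm_fsum a A : F A -> `|fsum a A| `^ p = psum p a A.
Proof.
have [c -> cE] := fsum_c00 a A.
move=> FA; apply/eqP; rewrite eq_le; apply/andP; split; last first.
  apply: le_trans (psum_le_iota _ FA); rewrite le_eqVlt; apply/orP; left; apply/eqP.
  by apply: psum_eq => i iA; rewrite cE iA.
rewrite -[leRHS](powR_invK p0 (psum_ge0 _ _ _)) (ler_powR2 p0) ?powR_ge0//.
apply: iota_le => [|B FB]; first exact: powR_ge0.
rewrite powR_invK ?psum_ge0//; apply: (@le_trans _ _ (psum p c A)).
  by apply: psum_supp_le => // i _; rewrite cE; case: ifP; rewrite ?eqxx.
by rewrite le_eqVlt; apply/orP; left; apply/eqP/psum_eq => i iA; rewrite cE iA.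
Qed.

(** The projection onto the coordinates in [A] is a contraction on [c00]. In the completion only
    single coordinates are controlled so far, so [x] is replaced by some [c'] at distance less than
    [r / (n + 1)]: the [n] coordinate errors and this distance add up to at most [r]. *)
Lemma fsum_coord_dist (x : X) (c : c00 R) A : F A ->
  `|fsum (coord x) A - fsum c A| <= `|x - iota c|.
Proof.
move=> FA; apply/ler_addgt0Pl => r r0.
pose n : R := (size (enum_fset A))%:R.
have n0 : 0 < n + 1 by rewrite ltr_wpDl.
have [c' xc'] := iota_dense x (divr_gt0 r0 n0).
have le1 : `|fsum (coord x) A - fsum c' A| <= n * (r / (n + 1)).
  rewrite fsumB; apply: le_trans (ler_norm_sum _ _ _) _.
  apply: (@le_trans _ _ (\sum_(i <- A) r / (n + 1))).
    apply: ler_sum => i _; rewrite normrZ -[leRHS]mulr1.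
    apply: ler_pM => //; first exact: le_trans (coordE _ _ _) (ltW xc').
    apply: iota_le => // B FB; rewrite powR1.
    apply: (@le_trans _ _ (psum p (c00_basis R i) [fset i])).
      apply: psum_supp_le => // j _; rewrite inE /=.
      by case: (j == i) => //=; rewrite eqxx.
    by rewrite psum1 /= eqxx normr1 powR1.
  by rewrite big_const_seq count_predT iter_addr_0 mulr_natl.
have le2 : `|fsum c' A - fsum c A| <= `|iota c' - iota c|.
  rewrite fsumB -(ler_powR2 p0)// norm_fsum// -raddfB; exact: (psum_le_iota (c' - c) FA).
have le3 := ler_distD (fsum c' A) (fsum (coord x) A) (fsum c A).
have le4 := ler_distD x (iota c') (iota c); rewrite (distrC (iota c') x) in le4.
have : n * (r / (n + 1)) + r / (n + 1) = r.
  by rewrite -{2}[r / _]mul1r -mulrDl mulrCA mulfV ?mulr1// gt_eqF.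
lra.
Qed.

Lemma psum_coord_le (x : X) A : F A -> psum p (coord x) A <= `|x| `^ p.
Proof.
move=> FA; rewrite -norm_fsum// (ler_powR2 p0)//.
have := fsum_coord_dist x 0 FA; rewrite raddf0 subr0.
rewrite (_ : fsum (0 : c00 R) A = 0) ?subr0//.
by rewrite /fin_sum big1// => i _; exact: scale0r.
Qed.

Lemma completion_schreier_space : schreier_space F p e coord.
Proof.
split.
- exact: coordD.
- exact: coordZ.
- by move=> i j; rewrite coord_iota.
- move=> x r r0; split=> [xr A FA|xr].
    by apply: le_trans (psum_coord_le x FA) _; rewrite (ler_powR2 p0).
  apply/ler_addgt0Pl => s s0; have s20 : 0 < s / 2 by rewrite divr_gt0.
  have [c xc] := iota_dense x s20.
  have cr : `|iota c| <= r + s / 2.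
    apply: iota_le => [|A FA]; first by rewrite addr_ge0// ltW.
    rewrite -norm_fsum// (ler_powR2 p0)//; last by rewrite addr_ge0// ltW.
    have := fsum_coord_dist x c FA.
    have : `|fsum (coord x) A| <= r by rewrite -(ler_powR2 p0)// norm_fsum// xr.
    have := ler_normB (fsum (coord x) A) (fsum (coord x) A - fsum c A).
    rewrite opprB addrC subrK; lra.
  have := ler_normD (x - iota c) (iota c); rewrite subrK; lra.
- move=> x r r0; have [c xc] := iota_dense x r0.
  have [N cN] := c00_suppP c; exists N => A FA AN.
  rewrite (@psum_eq _ _ _ (coord (x - iota c))) => [|i iA].
    by apply: le_trans (psum_coord_le _ FA) _; rewrite (ler_powR2 p0) ?(ltW r0) ?(ltW xc).
  by rewrite coordD -scaleN1r coordZ coord_iota cN ?AN// mulr0 addr0.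
Qed.

End Coordinates.

(** * Norming sets and maximal sets *)

Definition initial (n : nat) : {fset nat} := [fset i | i in seq.iota 0 n].

Lemma in_initial n i : (i \in initial n) = (i < n)%N.
Proof. by rewrite !inE mem_iota. Qed.

Section SchreierSpace.
Context {R : realType} {F : set {fset nat}} (hF : schreier_like F) {p : R} (hp : 1 <= p).
Context {X : normedModType R} {e : nat -> X} {co : X -> nat -> R}
  (hX : schreier_space F p e co).
Implicit Types (x y : X) (A B : {fset nat}) (i j k : nat).

Let p0 : 0 < p. Proof. exact: lt_le_trans hp. Qed.
Let pn0 : p != 0. Proof. by rewrite gt_eqF. Qed.

Lemma co0 i : co 0 i = 0.
Proof. by rewrite -(scale0r (0 : X)) (coZ hX) mul0r. Qed.

Lemma coN x i : co (- x) i = - co x i.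
Proof. by rewrite -scaleN1r (coZ hX) mulN1r. Qed.

Lemma coB x y i : co (x - y) i = co x i - co y i.
Proof. by rewrite (coD hX) coN. Qed.

Lemma co_fin_sum a A i : co (fin_sum e a A) i = if i \in A then a i else 0.
Proof.
have val_sum (s : seq nat) (f : nat -> X) : co (\sum_(j <- s) f j) i = \sum_(j <- s) co (f j) i.
  by elim: s => [|j s IH]; rewrite ?big_nil ?co0// !big_cons (coD hX) IH.
rewrite val_sum; case: ifPn => iA.
  rewrite (big_fsetD1 i)//= big_seq big1 ?addr0.
    by rewrite (coZ hX) (co_e hX) eqxx mulr1.
  move=> j; rewrite !inE => /andP[ji _].
  by rewrite (coZ hX) (co_e hX) eq_sym (negbTE ji) mulr0.
rewrite big_seq big1// => j jA; rewrite (coZ hX) (co_e hX).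
by case: eqP jA iA => [-> ->//|_ _ _]; rewrite mulr0.
Qed.

Lemma psum_le_norm x A : F A -> psum p (co x) A <= `|x| `^ p.
Proof. by move=> FA; have [+ _] := normP hX x (normr_ge0 x); apply. Qed.

Lemma norm_le x r : 0 <= r -> (forall A, F A -> psum p (co x) A <= r `^ p) -> `|x| <= r.
Proof. by move=> r0; have [_] := normP hX x r0. Qed.

Lemma norm_le1 x : (forall A, F A -> psum p (co x) A <= 1) -> `|x| <= 1.
Proof. by move=> x1; apply: norm_le => // A; rewrite powR1; exact: x1. Qed.

Lemma psum_le1 x A : `|x| <= 1 -> F A -> psum p (co x) A <= 1.
Proof.
move=> x1 /(psum_le_norm x) /le_trans; apply.
by move: x1; rewrite -(ler_powR2 p0)// powR1.
Qed.

Lemma co_le x i : `|co x i| <= `|x|.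
Proof.
rewrite -(ler_powR2 p0)//; apply: le_trans (psum_le_norm x (slike1 hF i)).
by rewrite psum1.
Qed.

Lemma co_inj x y : co x =1 co y -> x = y.
Proof.
move=> xy; apply/eqP; rewrite -subr_eq0 -normr_le0; apply: norm_le => // A FA.
by rewrite powR0// psum0// => i _; rewrite coB xy subrr.
Qed.

Lemma norm_co_le x y : (forall i, `|co x i| <= `|co y i|) -> `|x| <= `|y|.
Proof.
move=> xy; apply: norm_le => // A FA; apply: le_trans (psum_le_norm y FA).
by apply: psum_le => //; exact: ltW.
Qed.

Lemma norm_co_eq x y : (forall i, `|co x i| = `|co y i|) -> `|x| = `|y|.
Proof. by move=> xy; apply/eqP; rewrite eq_le !norm_co_le// => i; rewrite xy. Qed.

Lemma norm_e i : `|e i| = 1.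
Proof.
apply/eqP; rewrite eq_le; apply/andP; split.
  apply: norm_le1 => A FA; apply: (@le_trans _ _ (psum p (co (e i)) [fset i])).
    apply: psum_supp_le => // j _; rewrite (co_e hX) inE.
    by case: (j == i) => //=; rewrite eqxx.
  by rewrite psum1 (co_e hX) eqxx normr1 powR1.
by apply: le_trans (co_le _ i); rewrite (co_e hX) eqxx normr1.
Qed.

Lemma fset_bound A : exists n, {in A, forall i, (i < n)%N}.
Proof.
exists (\max_(i <- A) i).+1 => i iA; rewrite ltnS.
exact: (@leq_bigmax_seq _ (enum_fset A) xpredT id).
Qed.

Lemma co_cvg0 x r : 0 < r -> exists N, forall i, (N <= i)%N -> `|co x i| <= r.
Proof.
move=> /[dup] r0 /(co_tail hX x)[N xN]; exists N => i Ni.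
rewrite -(ler_powR2 p0)//; last exact: ltW.
have := xN _ (slike1 hF i); rewrite psum1; apply.
by move=> j; rewrite inE => /eqP ->.
Qed.

Lemma fin_sum_approx x r : 0 < r ->
  exists N, forall n, (N <= n)%N -> `|x - fin_sum e (co x) (initial n)| <= r.
Proof.
move=> /[dup] r0 /(co_tail hX x)[N xN]; exists N => n Nn.
apply: norm_le => [|A FA]; first exact: ltW.
have FA' : F [fset i in A | (n <= i)%N].
  by apply: (slike_sub hF FA); apply/fsubsetP => i; rewrite !inE => /andP[].
apply: le_trans (xN _ FA' _) => [|i]; last first.
  by rewrite !inE => /andP[_]; exact: leq_trans.
rewrite (@psum_eq _ _ (co x) (co (x - fin_sum e (co x) (initial n)))).
  apply: psum_supp_le => // i iA; rewrite coB co_fin_sum in_initial !inE iA/=.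
  by case: ltnP => // _; rewrite subrr eqxx.
move=> i; rewrite !inE coB co_fin_sum => /andP[_ ni].
by rewrite in_initial ltnNge ni subr0.
Qed.

(* Compactness of F: deciding successively whether each n belongs to the
   near-maximizers yields initial segments of a set, which is finite by
   [slike_chain]. *)
Lemma norm_attained x : exists2 A, F A & psum p (co x) A = `|x| `^ p.
Proof.
have F0 : F fset0 by exact (slike_sub hF (slike1 hF 0%N) (fsub0set _)).
have [->|xn0] := eqVneq x 0.
  by exists fset0 => //; rewrite psum_fset0 normr0 powR0.
(* [E] is the common trace below [n] of members of [F] whose sums come arbitrarily close to the p-th
   power of the norm. *)
pose good n (E : {fset nat}) := {in E, forall i, (i < n)%N} /\
  forall r, r < `|x| `^ p -> exists A, [/\ F A, r < psum p (co x) A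
    & forall i, (i < n)%N -> (i \in A) = (i \in E)].
have good0 : good 0%N fset0.
  split=> // r rx; apply: contrapT => nA.
  have rx' : 0 <= Num.max r 0 < `|x| `^ p.
    by rewrite le_max lexx orbT/= gt_max rx powR_gt0// normr_gt0.
  have : `|x| <= Num.max r 0 `^ p^-1.
    apply: norm_le => [|A FA]; first exact: powR_ge0.
    rewrite powR_invK//; last by case/andP: rx'.
    rewrite le_max leNgt; apply/orP; left; apply/negP => rA.
    by apply: nA; exists A.
  rewrite -(ler_powR2 p0) ?powR_ge0// powR_invK//; last by case/andP: rx'.
  by case/andP: rx' => _; rewrite ltNge => /negP.
have goodS n (E : {fset nat}) : good n E -> good n.+1 (n |` E) \/ good n.+1 E.
  move=> [En gE]; apply: contrapT => /not_orP[g1 g2].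
  have [r1 [r1x nr1]] : exists r, r < `|x| `^ p /\ forall A, F A -> r < psum p (co x) A ->
      (forall i, (i < n)%N -> (i \in A) = (i \in E)) -> n \notin A.
    apply: contrapT => nr; apply: g1; split=> [i|r rx].
      by rewrite !inE => /orP[/eqP->//|/En/ltnW].
    apply: contrapT => nA; apply: nr; exists r; split=> // A FA rA AE.
    apply/negP => nAi; apply: nA; exists A; split=> // i; rewrite ltnS leq_eqVlt !inE.
    by move=> /orP[/eqP->|lt_in]; [rewrite eqxx|rewrite AE// ltn_eqF].
  have [r2 [r2x nr2]] : exists r, r < `|x| `^ p /\ forall A, F A -> r < psum p (co x) A ->
      (forall i, (i < n)%N -> (i \in A) = (i \in E)) -> n \in A.
    apply: contrapT => nr; apply: g2; split=> [i /En/ltnW//|r rx].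
    apply: contrapT => nA; apply: nr; exists r; split=> // A FA rA AE.
    apply: contrapT => nAi; apply: nA; exists A; split=> // i; rewrite ltnS leq_eqVlt.
    move=> /orP[/eqP->|]; last exact: AE.
    rewrite (negbTE (introN idP nAi)); apply/esym/negbTE/negP => /En.
    by rewrite ltnn.
  have r12 : Num.max r1 r2 < `|x| `^ p by rewrite gt_max r1x.
  have [A [FA + AE]] := gE _ r12.
  by rewrite gt_max => /andP[/(nr1 _ FA) + /(nr2 _ FA)] => /(_ AE)/negP + /(_ AE).
pose E := fix E n := if n is m.+1 then
  if `[< good m.+1 (m |` E m) >] then m |` E m else E m else fset0.
have gE n : good n (E n).
  elim: n => //= n IH; case: ifPn => /asboolP// ng.
  by have [|] := goodS _ _ IH.
have FE n : F (E n).
  have [En gEn] := gE n.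
  have x1 : -1 < `|x| `^ p by rewrite (@lt_le_trans _ _ 0)// powR_ge0.
  have [A [FA _ AE]] := gEn _ x1.
  apply: (slike_sub hF FA); apply/fsubsetP => i iE; by rewrite AE ?En.
have Emono m n : (m <= n)%N -> E m `<=` E n.
  move=> /subnKC <-; elim: (n - m)%N => [|l IH]; first by rewrite addn0.
  rewrite addnS /=; case: ifP => // _; apply: fsubset_trans IH _; exact: fsubsetUr.
have [N EN] : exists N, forall n, (N <= n)%N -> E n = E N.
  apply: contrapT => nN.
  have /choice[f fP] : forall N, exists n, (N <= n)%N /\ n \in E n.+1.
    move=> N; apply: contrapT => nn; apply: nN; exists N => n /subnKC <-.
    elim: (n - N)%N => [|l IH]; first by rewrite addn0.
    rewrite addnS /=; case: ifPn => // gNl; exfalso; apply: nn; exists (N + l)%N.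
    by rewrite leq_addr /= gNl !inE eqxx.
  pose k := fix k i := if i is j.+1 then f (k j).+1 else f 0%N.
  have kS i : (k i < k i.+1)%N by have [+ _] := fP (k i).+1.
  have kE i : k i \in E (k i).+1 by case: i => [|i]; apply (fP _).2.
  have kincr : {homo k : m n / (m < n)%N} by apply: homo_ltn => //; exact: ltn_trans.
  have [n] := slike_chain hF kincr; apply; apply: (slike_sub hF (FE (k n))).
  apply/fsubsetP => _ /imfsetP[i /= + ->]; rewrite mem_iota => /= lt_in.
  by apply: (fsubsetP (Emono (k i).+1 _ _)) => //; exact: kincr.
exists (E N) => //; apply/eqP; rewrite eq_le psum_le_norm//=.
apply/ler_addgt0Pl => r r0.
(* One half of [r] pays for choosing a near-maximizer, the other for its points from [n] on; below
   [n] it coincides with [E N]. *)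
have r20 : 0 < (r / 2) `^ p^-1 by rewrite powR_gt0// divr_gt0.
have [N' tN] := co_tail hX x r20; rewrite powR_invK// in tN; last by rewrite divr_ge0// ltW.
pose n := maxn N N'; have [_ gn] := gE n.
have xr : `|x| `^ p - r / 2 < `|x| `^ p by rewrite ltrBlDr ltrDl divr_gt0.
have [A [FA rA AE]] := gn _ xr.
have FA' : F [fset i in A | ~~ (i < n)%N].
  by apply: (slike_sub hF FA); apply/fsubsetP => i; rewrite !inE => /andP[].
have := tN _ FA' _; move: rA; rewrite {1}/psum (big_fsetID _ (fun i => (i < n)%N))/=.
rewrite -/(psum p (co x) _) -/(psum p (co x) _) => rA tl.
have {}tl : psum p (co x) [fset i in A | ~~ (i < n)%N] <= r / 2.
  by apply: tl => i; rewrite !inE -leqNgt geq_max => /andP[_ /andP[]].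
have : psum p (co x) [fset i in A | (i < n)%N] <= psum p (co x) (E N).
  apply: psum_sub; apply/fsubsetP => i; rewrite !inE => /andP[iA lt_in].
  by rewrite -(EN n) ?leq_maxl// -AE.
lra.
Qed.

Definition off i x := x - co x i *: e i.

Lemma co_off i x j : co (off i x) j = if j == i then 0 else co x j.
Proof.
by rewrite coB (coZ hX) (co_e hX); case: eqP => [->|_]; rewrite ?mulr1 ?subrr// mulr0 subr0.
Qed.

(** Raising the i-th coordinate to a value [C] larger than the norm of the rest forces a norming set
    to contain [i], and the other coordinates are unchanged. *)
Lemma psum_attained_at x i : exists A, [/\ F A, i \in A
  & forall B, F B -> i \in B -> psum p (co x) (B `\ i) <= psum p (co x) (A `\ i)].
Proof.
pose C := `|off i x| + 1; pose y := off i x + C *: e i.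
have C0 : 0 < C by rewrite ltr_wpDl.
have coy j : co y j = if j == i then C else co x j.
  rewrite (coD hX) co_off (coZ hX) (co_e hX).
  by case: eqP => _; rewrite ?mulr1 ?add0r ?mulr0 ?addr0.
have [A FA yA] := norm_attained y.
have eqi B : psum p (co y) (B `\ i) = psum p (co x) (B `\ i).
  by apply: psum_eq => j; rewrite !inE => /andP[/negbTE ji _]; rewrite coy ji.
have iA : i \in A.
  apply: contraT => iA.
  have : psum p (co y) [fset i] <= psum p (co y) A by rewrite yA psum_le_norm//; exact: slike1.
  rewrite psum1 coy eqxx ger0_norm ?(ltW C0)//.
  rewrite (@psum_eq _ _ (co y) (co (off i x))) => [CA|j jA]; last first.
    by rewrite coy co_off; case: eqP jA => // ->; rewrite (negbTE iA).
  have := le_trans CA (psum_le_norm _ FA); rewrite ler_powR2// ?(ltW C0)//.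
  by rewrite /C; lra.
exists A; split=> // B FB iB; have := psum_le_norm y FB.
by rewrite -yA (psumD1 _ _ iA) (psumD1 _ _ iB) lerD2l !eqi.
Qed.

(** Pushing the new points beyond [N] lets two maximal sets meet in a prescribed point only, and
    makes them invisible to a vector whose coordinates vanish from [N] on. *)
Lemma maximal_far A N : F A ->
  exists B, [/\ A `<=` B, maximal_in F B & {in B, forall i, i \in A \/ (N <= i)%N}].
Proof.
move=> FA.
have [|B n PB|B [AB PB mB]] := slike_extend hF (P := fun B => {in B, forall i, i \in A \/ (N <= i)%N}) FA.
- by move=> i; left.
- have [k Bk] := fset_bound B; exists (maxn (maxn n N) k); split.
  + by rewrite leq_max leq_maxl.
  + by move=> i /Bk ik; rewrite leq_max ik orbT.
  + move=> i; rewrite !inE => /orP[/eqP->|/PB//].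
    by right; rewrite !leq_max leqnn orbT.
- by exists B.
Qed.

(** A member of [F] other than [A] misses a point of [A], by maximality; it loses [r^p] from the sum
    of [u], which is the most that [y] can contribute. The subadditivity hypothesis covers two uses:
    [y] vanishing on [A], and [p = 1]. *)
Lemma maximal_perturb A (u y : X) (r : R) : maximal_in F A -> 0 <= r ->
  {in A, forall i, `|co u i| = r} -> (forall i, i \notin A -> co u i = 0) ->
  psum p (co u) A = 1 ->
  (forall B, psum p (co (u + y)) B <= psum p (co u) B + psum p (co y) B) ->
  psum p (co (u + y)) A <= 1 -> `|y| <= r -> `|u + y| <= 1.
Proof.
move=> [FA Amax] r0 uA u0 u1 uy uyA yr; apply: norm_le1 => B FB.
have [AB|/fsubsetPn[i iA iB]] := boolP (A `<=` B); first by rewrite (Amax B).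
apply: le_trans (uy B) _.
have : psum p (co u) B <= psum p (co u) (A `\ i).
  apply: psum_supp_le => // j jB; rewrite !inE => uj.
  have -> /= : j != i by apply: contraNneq iB => <-.
  by apply: contraNT uj => /u0 ->.
have := psum_le_norm y FB; have : `|y| `^ p <= r `^ p by rewrite ler_powR2.
by move: u1; rewrite (psumD1 _ _ iA) uA//; lra.
Qed.

Lemma maximal_neq0 A : maximal_in F A -> (0 < #|` A|)%N.
Proof.
move=> [FA Amax]; rewrite lt0n; apply/negP => /eqP/cardfs0_eq A0.
have := Amax _ (slike1 hF 0%N); rewrite A0 fsub0set => /(_ isT)/fsetP/(_ 0%N).
by rewrite !inE.
Qed.

Definition flat A (s : nat -> R) : X := fin_sum e (fun i => (#|` A|%:R^-1) `^ p^-1 * s i) A.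

Lemma flatP A s : maximal_in F A -> {in A, forall i, `|s i| = 1} ->
  let r := (#|` A|%:R^-1) `^ p^-1 in
  [/\ 0 < r, {in A, forall i, `|co (flat A s) i| = r},
      forall i, i \notin A -> co (flat A s) i = 0 & psum p (co (flat A s)) A = 1].
Proof.
move=> mA sA r; have A0 : 0 < #|` A|%:R :> R by rewrite ltr0n maximal_neq0.
have r0 : 0 < r by rewrite powR_gt0// invr_gt0.
have uA : {in A, forall i, `|co (flat A s) i| = r}.
  by move=> i iA; rewrite co_fin_sum iA normrM sA// mulr1 gtr0_norm.
split=> // [i iA|]; first by rewrite co_fin_sum (negbTE iA).
rewrite /psum (eq_big_seq (fun=> r `^ p)) => [|i /uA -> //].
rewrite big_const_seq count_predT iter_addr_0 powR_invK ?invr_ge0 ?ltW//.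
by rewrite -[LHS]mulr_natl mulfV ?gt_eqF.
Qed.

End SchreierSpace.

Lemma norm_eq1 {R : realType} (a : R) : `|a| = 1 -> a = 1 \/ a = -1.
Proof. by move=> /eqP; rewrite eqr_norml => /andP[/orP[]/eqP]; [left|right]. Qed.

(* Unlike Num.sg, never 0. *)
Definition sgn1 {R : realType} (a : R) : R := if 0 <= a then 1 else -1.

Lemma norm_sgn1 {R : realType} (a : R) : `|sgn1 a| = 1.
Proof. by rewrite /sgn1; case: ifP; rewrite ?normrN normr1. Qed.

Lemma sgn1_mul {R : realType} (a : R) : sgn1 a * a = `|a|.
Proof.
rewrite /sgn1; case: ifPn => [a0|]; first by rewrite mul1r ger0_norm.
by rewrite -ltNge => /ltr0_norm ->; rewrite mulN1r.
Qed.

(** * Linear isometries as signed permutations of the basis *)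

Section LinearIsometries.
Context {R : realType} {F : set {fset nat}} (hF : schreier_like F) {p : R} (hp : 1 <= p).
Context {X : normedModType R} {e : nat -> X} {co : X -> nat -> R}
  (hX : schreier_space F p e co).
Implicit Types (x y : X) (A B : {fset nat}) (i j k : nat).

Let p0 : 0 < p. Proof. exact: lt_le_trans hp. Qed.
Let pn0 : p != 0. Proof. by rewrite gt_eqF. Qed.

Record lin_isometry (g h : {linear X -> X}) : Prop := LinIsometry {
  liK : forall x, h (g x) = x;
  liK' : forall x, g (h x) = x;
  li_norm : forall x, `|g x| = `|x|
}.

Lemma lin_isometry_sym g h : lin_isometry g h -> lin_isometry h g.
Proof. by move=> [gK hK gn]; split=> // x; rewrite -gn hK. Qed.

Definition vanish A x := {in A, forall i, co x i = 0}.

(* Adding a small y that vanishes on A to the flat vector u does not increase the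
   norm; by strict convexity g y vanishes on every set norming g u. *)
Lemma vanish_image (g h : {linear X -> X}) A : 1 < p -> lin_isometry g h ->
  maximal_in F A ->
  exists2 B, maximal_in F B & forall y, vanish A y -> vanish B (g y).
Proof.
move=> p1 [_ _ gn] mA.
pose u : X := flat (e := e) (p := p) A (fun=> 1).
have [r0 uA uA0 u1] := flatP hF hp hX mA (s := fun=> 1) (fun _ _ => normr1 _).
set r := _ `^ _ in r0 uA; rewrite -/u in uA uA0 u1.
have [B' FB' vB'] := norm_attained hF hp hX (g u).
have [B [B'B mB _]] := maximal_far hF 0 FB'.
exists B => // y yA.
wlog yr : y yA / `|y| <= r => [wl|].
  have [y0|yn0] := eqVneq y 0; first by move=> i _; rewrite y0 raddf0 (co0 hX).
  have yp : 0 < `|y| by rewrite normr_gt0.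
  have := wl ((r / `|y|) *: y); rewrite linearZ => wl' i iB.
  have : co (r / `|y| *: g y) i = 0.
    apply: wl' => //.
      by move=> j jA; rewrite (coZ hX) yA// mulr0.
    by rewrite normrZ ger0_norm ?divr_ge0// ?divfK// ?gt_eqF// ltW.
  rewrite (coZ hX) => /eqP; rewrite mulf_eq0 => /orP[|/eqP//].
  by rewrite mulf_eq0 invr_eq0 !gt_eqF.
have pert z : vanish A z -> `|z| <= r -> `|u + z| <= 1.
  move=> zA zr; apply: (maximal_perturb hp hX mA (ltW r0)) => //.
  - move=> C; rewrite -psumD//; last first.
      by move=> i _; have [/zA|/uA0] := boolP (i \in A); [right|left].
    by rewrite le_eqVlt; apply/orP; left; apply/eqP/psum_eq => i _; rewrite (coD hX).
  - rewrite -u1 le_eqVlt; apply/orP; left; apply/eqP/psum_eq => i iA.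
    by rewrite (coD hX) zA// addr0.
have yN : vanish A (- y) by move=> i iA; rewrite (coN hX) yA// oppr0.
have gp : `|g u + g y| <= 1 by rewrite -raddfD gn pert.
have gm : `|g u - g y| <= 1 by rewrite -raddfB gn pert// normrN.
have u_ge1 : 1 <= psum p (co (g u)) B.
  apply: le_trans (psum_sub _ _ B'B); rewrite vB' gn.
  have [FA _] := mA; have := psum_le_norm hX u FA.
  by rewrite u1.
have FB : F B by case: mB.
have := psum_le1 hp hX gp FB; have := psum_le1 hp hX gm FB.
move=> sm sp i iB; apply: contrapT => /eqP gyi.
have : 2 * psum p (co (g u)) B < psum p (co (g u + g y)) B + psum p (co (g u - g y)) B.
  rewrite !(psumD1 _ _ iB) mulrDr addrACA; apply: ltr_leD.
    by rewrite (coD hX) (coB hX); exact: powR_midpoint.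
  rewrite /psum mulr_sumr -big_split; apply: ler_sum => j _.
  by rewrite (coD hX) (coB hX); exact: powR_midpoint_le.
lra.
Qed.

(** Going forth with [g] and back with [h] leads to a maximal [A'] on which every vector vanishing
    on [A] vanishes. Testing this on basis vectors gives the inclusion of [A'] in [A], and
    maximality of [A'] gives equality. *)
Lemma vanish_iff (g h : {linear X -> X}) A : 1 < p -> lin_isometry g h ->
  maximal_in F A ->
  exists2 B, maximal_in F B & forall y, vanish A y <-> vanish B (g y).
Proof.
move=> p1 gh mA; have [B mB AB] := vanish_image p1 gh mA.
have [A' mA' BA'] := vanish_image p1 (lin_isometry_sym gh) mB.
exists B => // y; split=> [|/BA']; first exact: AB.
suff -> : A = A' by rewrite (liK gh).
apply: mA'.2; first by case: mA.
apply/fsubsetP => k kA'; apply: contraT => kA.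
have : vanish A (e k) by move=> i iA; rewrite (co_e hX); case: eqP iA kA => // -> ->.
move=> /AB/BA'/(_ _ kA'); rewrite (liK gh) (co_e hX) eqxx => /eqP.
by rewrite oner_eq0.
Qed.

(** The hyperplane where the i-th coordinate is 0 thus becomes the sum of the subspaces [vanish A]
    and [vanish B], which is how single coordinates are reached from maximal sets. *)
Lemma maximal_pair i : exists A B, [/\ maximal_in F A, maximal_in F B,
  i \in A, i \in B & {in A, forall j, j \in B -> j = i}].
Proof.
have [A [iA mA _]] := maximal_far hF 0 (slike1 hF i).
have [n An] := fset_bound A.
have [B [iB mB Bn]] := maximal_far hF n (slike1 hF i).
exists A, B; rewrite -!fsub1set; split=> // j /An jn /Bn[|]; first by rewrite inE => /eqP.
by rewrite leqNgt jn.
Qed.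

Lemma vanish_split A B y : {in A, forall j, j \in B -> co y j = 0} ->
  exists y1 y2, [/\ y = y1 + y2, vanish B y1 & vanish A y2].
Proof.
move=> AB; exists (fin_sum e (co y) A), (y - fin_sum e (co y) A); split.
- by rewrite addrC subrK.
- by move=> j jB; rewrite (co_fin_sum hX); case: ifP => // jA; exact: AB.
- by move=> j jA; rewrite (coB hX) (co_fin_sum hX) jA subrr.
Qed.

Lemma coord_image (g h : {linear X -> X}) i : 1 < p -> lin_isometry g h ->
  exists j, forall y, co y i = 0 <-> co (g y) j = 0.
Proof.
move=> p1 gh; have [A1 [A2 [mA1 mA2 iA1 iA2 A12]]] := maximal_pair i.
have [B1 mB1 AB1] := vanish_iff p1 gh mA1.
have [B2 mB2 AB2] := vanish_iff p1 gh mA2.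
have yB y : co y i = 0 <-> {in B1, forall j, j \in B2 -> co (g y) j = 0}.
  split=> [yi|gy].
    have [j jA1 /(A12 _ jA1) ->//|y1 [y2 [-> /AB2 y1B /AB1 y2B]] j jB1 jB2] :=
      @vanish_split A1 A2 y.
    by rewrite raddfD (coD hX) y1B// y2B// addr0.
  have [z1 [z2 [gyE z1B z2B]]] := vanish_split gy.
  have {}z1B : vanish A2 (h z1) by apply/AB2; rewrite (liK' gh).
  have {}z2B : vanish A1 (h z2) by apply/AB1; rewrite (liK' gh).
  by rewrite -(liK gh y) gyE raddfD (coD hX) z1B// z2B// addr0.
have [j jB1 jB2] : exists2 j, j \in B1 & j \in B2.
  apply: contrapT => nj; have : co (e i) i = 0.
    by apply/yB => j jB1 jB2; exfalso; apply: nj; exists j.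
  by rewrite (co_e hX) eqxx => /eqP; rewrite oner_eq0.
exists j => y; split=> [/yB|gyj]; first exact.
apply/yB => k kB1 kB2; apply: contrapT => gyk.
have jk : j != k by apply: contra_notN gyk => /eqP <-.
have hn (l : nat) : l \in B1 -> l \in B2 -> co (h (e l)) i != 0.
  move=> l1 l2; apply/negP => /eqP/yB/(_ l l1 l2); rewrite (liK' gh) (co_e hX) eqxx.
  by move/eqP; rewrite oner_eq0.
(* A second common point [k] would make a hyperplane correspond to a subspace of codimension at
   least two: this combination has i-th coordinate 0, but its image has a nonzero j-th one. *)
have : co (co (h (e k)) i *: h (e j) - co (h (e j)) i *: h (e k)) i = 0.
  by rewrite (coB hX) !(coZ hX) mulrC subrr.
move/yB => /(_ j jB1 jB2); rewrite linearB !linearZ/= !(liK' gh) (coD hX) !(coZ hX) (coN hX) !(co_e hX).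
rewrite eqxx (negbTE jk) oppr0 mulr0 addr0 mulr1 => /eqP.
by rewrite (negbTE (hn _ kB1 kB2)).
Qed.

Definition signed_basis (g : {linear X -> X}) :=
  forall k, exists j t, `|t| = 1 /\ g (e k) = t *: e j.

Lemma signed_basis_gt1 (g h : {linear X -> X}) : 1 < p -> lin_isometry g h ->
  signed_basis g.
Proof.
move=> p1 gh k; have [j jP] := coord_image k p1 gh.
have gekE : g (e k) = co (g (e k)) j *: e j.
  apply: (co_inj hp hX) => l; rewrite (coZ hX) (co_e hX).
  have [->|lj] := eqVneq l j; first by rewrite mulr1.
  rewrite mulr0; have [i iP] := coord_image l p1 (lin_isometry_sym gh).
  apply/iP; rewrite (liK gh) (co_e hX); case: eqP => // ik; exfalso.
  have : co (e j) l = 0 by rewrite (co_e hX) (negbTE lj).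
  move/iP; rewrite ik => /jP; rewrite (liK' gh) (co_e hX) eqxx => /eqP.
  by rewrite oner_eq0.
exists j, (co (g (e k)) j); split=> //.
have : `|g (e k)| = 1 by rewrite (li_norm gh) (norm_e hF hp hX).
by rewrite {1}gekE normrZ (norm_e hF hp hX) mulr1.
Qed.

(* For p = 1 the norm is, near the flat vector u with signs s on A, the
   functional phi; hence phi is psi \o g for any sign functional psi norming
   g u. *)
Lemma signed_sum (g h : {linear X -> X}) A (s : nat -> R) k : p = 1 -> lin_isometry g h ->
  maximal_in F A -> {in A, forall i, `|s i| = 1} ->
  let t := \sum_(i <- A) s i * co (h (e k)) i in t = 0 \/ `|t| = 1.
Proof.
move=> p1 gh mA sA t.
pose u : X := flat (e := e) (p := p) A s.
have [r0 uA uA0 u1] := flatP hF hp hX mA sA.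
set r := _ `^ _ in r0 uA; rewrite -/u in uA uA0 u1.
pose phi x := \sum_(i <- A) s i * co x i.
have FA : F A by case: mA.
have ps (x : nat -> R) C : psum p x C = \sum_(i <- C) `|x i|.
  by apply: eq_bigr => i _; rewrite p1 powRr1.
have couE i : i \in A -> co u i = r * s i.
  by move=> iA; rewrite /u (co_fin_sum hX) iA.
have phiu : phi u = 1.
  rewrite -u1 ps; apply: eq_big_seq => i iA; rewrite uA// couE// mulrCA -expr2.
  by rewrite -(@real_normK R (s i)) ?num_real// sA// expr1n mulr1.
have [B FB vB] := norm_attained hF hp hX (g u).
have gu1 : psum p (co (g u)) B = 1.
  have := psum_le_norm hX u FA; rewrite vB (li_norm gh) u1 => le1.
  have : `|u| <= 1.
    rewrite -[u]addr0; apply: (maximal_perturb hp hX mA (ltW r0)) => //.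
    - by move=> C; rewrite addr0 lerDl psum_ge0.
    - by rewrite addr0 u1.
    - by rewrite normr0 ltW.
  by rewrite -(ler_powR2 p0)// powR1 => le2; apply/eqP; rewrite eq_le le1 le2.
pose psi x := \sum_(j <- B) sgn1 (co (g u) j) * co x j.
have psi_le x : psi x <= `|x|.
  have := psum_le_norm hX x FB; rewrite {2}p1 powRr1// ps; apply: le_trans.
  apply: ler_sum => j _; apply: le_trans (ler_norm _) _.
  by rewrite normrM norm_sgn1 mul1r.
have psiD x y : psi (x + y) = psi x + psi y.
  by rewrite /psi -big_split; apply: eq_bigr => j _; rewrite (coD hX) mulrDr.
have psiZ a x : psi (a *: x) = a * psi x.
  by rewrite /psi mulr_sumr; apply: eq_bigr => j _; rewrite (coZ hX) mulrCA.
have psiu : psi (g u) = 1.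
  by rewrite -gu1 ps; apply: eq_bigr => j _; rewrite sgn1_mul.
(* On [A] the entries of [u] dominate those of [y], so the absolute values of [u + y] sum to
   [phi (u + y) = 1]. Since [psi] has norm at most 1 and [psi (g u) = 1], nothing positive may be
   added. *)
have ker_le y : phi y = 0 -> `|y| <= r -> psi (g y) <= 0.
  move=> phiy yr.
  have : `|u + y| <= 1.
    apply: (maximal_perturb hp hX mA (ltW r0)) => //.
      move=> C; rewrite !ps -big_split; apply: ler_sum => i _.
      by rewrite (coD hX) ler_normD.
    rewrite ps (eq_big_seq (fun i => s i * co u i + s i * co y i)) => [|i iA].
      by rewrite big_split/= -/(phi u) -/(phi y) phiu phiy addr0.
    have [si|si] := norm_eq1 (sA _ iA).
    - rewrite (coD hX) couE// si !mul1r mulr1 ger0_norm//.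
      have := co_le hF hp hX y i; rewrite ler_norml; lra.
    - rewrite (coD hX) couE// si mulrN1 mulrNN mul1r ler0_norm; first by rewrite opprD opprK mulN1r.
      have := co_le hF hp hX y i; rewrite ler_norml; lra.
  rewrite -(li_norm gh) raddfD => /(le_trans (psi_le _)).
  by rewrite psiD psiu; lra.
have phiZ a x : phi (a *: x) = a * phi x.
  by rewrite /phi mulr_sumr; apply: eq_bigr => j _; rewrite (coZ hX) mulrCA.
have phiD x y : phi (x + y) = phi x + phi y.
  by rewrite /phi -big_split; apply: eq_bigr => j _; rewrite (coD hX) mulrDr.
have ker_le' y : phi y = 0 -> psi (g y) <= 0.
  move=> phiy; pose b := r / (`|y| + 1).
  have b0 : 0 < b by rewrite divr_gt0// ltr_wpDl.
  have := ker_le (b *: y); rewrite linearZ psiZ phiZ phiy mulr0 => /(_ erefl).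
  rewrite pmulr_rle0//; apply; rewrite normrZ gtr0_norm// /b mulrAC ler_pdivrMr ?ltr_wpDl//.
  by rewrite ler_pM2l// lerDl.
have ker0 y : phi y = 0 -> psi (g y) = 0.
  move=> phiy; apply/eqP; rewrite eq_le ker_le'//=.
  have := ker_le' (- y); rewrite raddfN -scaleN1r -[- g y]scaleN1r phiZ psiZ phiy mulr0.
  by move=> /(_ erefl); lra.
have psiphi x : psi (g x) = phi x.
  have : phi (x + (- phi x) *: u) = 0 by rewrite phiD phiZ phiu mulr1 subrr.
  by move/ker0; rewrite linearD linearZ psiD psiZ psiu; lra.
(* The number [t] is the value of [psi] at [e k]: a sign if [k] is in [B], and 0 otherwise. *)
rewrite -[t]/(phi (h (e k))) -psiphi (liK' gh) /psi.
have [kB|kB] := boolP (k \in B).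
  right; rewrite (big_fsetD1 k)//= big_seq big1 ?addr0.
    by rewrite (co_e hX) eqxx mulr1 norm_sgn1.
  by move=> j; rewrite !inE (co_e hX) => /andP[/negbTE ->]; rewrite mulr0.
left; rewrite big_seq big1// => j jB; rewrite (co_e hX).
by case: eqP jB kB => [-> ->|]//; rewrite mulr0.
Qed.

(** All signed sums of the coordinates of [h (e k.+1)] over a maximal set are 0 or of absolute value
    1. This makes each coordinate 0 or a sign, and two nonzero ones would produce a sum equal to 2.
    The index 0 is treated by hypothesis, because it forms no pair in [F] with another index. *)
Lemma signed_basis_1 (g h : {linear X -> X}) (t : R) : p = 1 -> lin_isometry g h ->
  `|t| = 1 -> h (e 0%N) = t *: e 0%N -> (forall x, co (h x) 0%N = t * co x 0%N) ->
  signed_basis h.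
Proof.
move=> p1 gh t1 he0 h0 [|k]; first by exists 0%N, t.
pose c := co (h (e k.+1)).
have ssum A s : maximal_in F A -> {in A, forall i, `|s i| = 1} ->
    \sum_(i <- A) s i * c i = 0 \/ `|\sum_(i <- A) s i * c i| = 1.
  exact: (@signed_sum g h A s k.+1 p1 gh).
have n1 : `|1 : R| = 1 by rewrite normr1.
(* Changing one sign alters the sum by less than 1 in absolute value, so it does not change; hence
   [c i] is 0. *)
have half i : `|c i| < 2^-1 -> c i = 0.
  move=> ci; have [A [iA mA _]] := maximal_far hF 0 (slike1 hF i).
  rewrite fsub1set in iA.
  have := ssum A (fun=> 1) mA (fun _ _ => n1).
  have := ssum A (fun j => if j == i then -1 else 1) mA.
  have s1 j : `|(if j == i then -1 else 1 : R)| = 1 by case: ifP; rewrite ?normrN.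
  move=> /(_ (fun j _ => s1 j)); rewrite !(big_fsetD1 i iA)/= eqxx mulN1r mul1r.
  have -> : \sum_(j <- A `\ i) (if j == i then -1 else 1) * c j = \sum_(j <- A `\ i) 1 * c j.
    by apply: eq_big_seq => j; rewrite !inE => /andP[/negbTE ->].
  move: ci; set b := \sum_(j <- _) _; rewrite ltr_norml => /andP[ci1 ci2].
  by move=> [h1|/norm_eq1[h1|h1]] [h2|/norm_eq1[h2|h2]]; lra.
(* Any positive bound below 1/2 makes [half] applicable to the far coordinates. *)
have q0 : 0 < 4^-1 :> R by rewrite invr_gt0 ltr0n.
have [N cN] := co_cvg0 hF hp hX (h (e k.+1)) q0.
have {}cN i : (N <= i)%N -> c i = 0.
  by move=> /cN ci; apply: half; rewrite (le_lt_trans ci)// ltf_pV2 ?posrE//; lra.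
have sum_far A B s : A `<=` B -> {in B, forall i, i \in A \/ (N <= i)%N} ->
    \sum_(i <- B) s i * c i = \sum_(i <- A) s i * c i.
  move=> AB Bfar; apply/esym/big_fset_incl => // i /Bfar[->//|/cN -> _].
  by rewrite mulr0.
have c01 i : c i = 0 \/ `|c i| = 1.
  have [A [iA mA Afar]] := maximal_far hF N (slike1 hF i).
  have := ssum A (fun=> 1) mA (fun _ _ => n1).
  by rewrite (sum_far _ _ _ iA Afar) !big_seq_fset1 mul1r.
have c0 : c 0%N = 0 by rewrite /c h0 (co_e hX) mulr0.
have [i ci] : exists i, c i != 0.
  apply: contrapT => nc.
  have : h (e k.+1) = 0.
    apply: (co_inj hp hX) => i; rewrite (co0 hX); apply: contrapT => ci; apply: nc.
    by exists i; apply/eqP.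
  move=> /(congr1 g)/(congr1 (co^~ k.+1)); rewrite (liK' gh) raddf0 (co0 hX) (co_e hX) eqxx.
  by move/eqP; rewrite oner_eq0.
have ci1 : `|c i| = 1 by case: (c01 i) ci => // ->; rewrite eqxx.
have i0 : (0 < i)%N by rewrite lt0n; apply: contraNneq ci => ->; rewrite c0.
exists i, (c i); split=> //; apply: (co_inj hp hX) => j; rewrite (coZ hX) (co_e hX).
have [->|ji] := eqVneq j i; first by rewrite mulr1.
rewrite mulr0 -/(c j); case: (c01 j) => // cj1.
have j0 : (0 < j)%N.
  rewrite lt0n; apply/eqP => j0; move: cj1; rewrite j0 c0 normr0 => /esym/eqP.
  by rewrite oner_eq0.
exfalso; have [A [ijA mA Afar]] := maximal_far hF N (slike2 hF i0 j0).
have := ssum A _ mA (fun l _ => norm_sgn1 (c l)).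
rewrite (sum_far _ _ _ ijA Afar) big_fsetU1/= ?inE 1?eq_sym// big_seq_fset1.
rewrite !sgn1_mul ci1 cj1 => -[|]; first lra.
by rewrite ger0_norm//; lra.
Qed.

(* The permutation pi of the indices preserves F.  If pi m < m, take a maximal
   set B of F with minimum m on which pi is increasing and pi b <= b: then
   [slike_dom_rcons] adds a point to B. *)
Lemma signed_basis_diag (g h : {linear X -> X}) : lin_isometry g h ->
  signed_basis g -> signed_basis h ->
  exists theta : nat -> R, (forall k, theta k = 1 \/ theta k = -1) /\
    forall x k, co (g x) k = theta k * co x k.
Proof.
move=> gh /choice[pi /choice[th piP]] /choice[rho /choice[et rhoP]].
have th1 k : `|th k| = 1 by have [] := piP k.
have gE k : g (e k) = th k *: e (pi k) by have [] := piP k.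
have rhopi k : rho (pi k) = k.
  have := liK gh (e k); rewrite gE linearZ/= (rhoP _).2 scalerA.
  move=> /(congr1 (co^~ k)); rewrite (coZ hX) !(co_e hX) eqxx.
  by case: eqP => // _ /eqP; rewrite mulr0 eq_sym oner_eq0.
have pirho k : pi (rho k) = k.
  have := liK' gh (e k); rewrite (rhoP k).2 linearZ/= gE scalerA.
  move=> /(congr1 (co^~ k)); rewrite (coZ hX) !(co_e hX) eqxx.
  by case: eqP => // _ /eqP; rewrite mulr0 eq_sym oner_eq0.
have pi_inj : injective pi by exact: can_inj rhopi.
have co_g x k : co (g x) (pi k) = th k * co x k.
  apply/eqP; rewrite -subr_eq0 -normr_le0; apply/ler_addgt0Pl => r r0; rewrite addr0.
  have r20 : 0 < r / 2 by rewrite divr_gt0.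
  have [N xN] := fin_sum_approx hF hp hX x r20.
  set n := maxn N k.+1; have {}xN := xN n (leq_maxl _ _).
  set z := fin_sum _ _ _ in xN.
  have coz : co z k = co x k by rewrite (co_fin_sum hX) in_initial leq_maxr.
  have cogz : co (g z) (pi k) = th k * co z k.
    have -> : g z = fin_sum e (fun j => co x (rho j) * th (rho j)) (pi @` initial n).
      rewrite /z linear_sum /fin_sum [RHS]big_imfset; last by move=> ? ? _ _ /pi_inj.
      by apply: eq_bigr => i _; rewrite linearZ/= gE scalerA rhopi.
    rewrite (co_fin_sum hX) coz rhopi mulrC mem_imfset//= in_initial ifT//.
    exact: leq_maxr.
  have -> : co (g x) (pi k) - th k * co x k = co (g (x - z)) (pi k).
    by rewrite raddfB (coB hX) cogz coz.
  apply: le_trans (co_le hF hp hX _ _) _; rewrite (li_norm gh); apply: le_trans xN _.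
  by rewrite ler_pdivrMr//; lra.
(* A set norming the image of the sum of the [e i] over [A] contains the whole image of [A], since
   each missing point would cost 1. *)
have piF A : F A -> F (pi @` A).
  move=> FA; pose x := fin_sum e (fun=> 1) A.
  have [B FB vB] := norm_attained hF hp hX (g x).
  apply: (slike_sub hF FB); apply/fsubsetP => _ /imfsetP[i /= iA ->].
  apply: contraT => iB; exfalso.
  have pieq : psum p (co (g x)) (pi @` A) = psum p (co x) A.
    rewrite /psum big_imfset/=; last by move=> ? ? _ _ /pi_inj.
    by apply: eq_bigr => j _; rewrite co_g normrM th1 mul1r.
  have : psum p (co (g x)) B <= psum p (co (g x)) ((pi @` A) `\ pi i).
    apply: psum_supp_le => // j jB gxj; rewrite !inE.
    have -> /= : j != pi i by apply: contraNneq iB => <-.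
    rewrite -(pirho j) mem_imfset//=; apply: contraNT gxj => jA.
    by rewrite -(pirho j) co_g (co_fin_sum hX) (negbTE jA) mulr0.
  have := psum_le_norm hX x FA; rewrite -pieq -(li_norm gh) -vB.
  rewrite (@psumD1 _ _ _ (pi @` A) (pi i)); last by rewrite mem_imfset.
  rewrite co_g (co_fin_sum hX) iA mulr1 th1 powR1; lra.
suff piE k : pi k = k.
  exists th; split=> [k|x k]; last by rewrite -{1}(piE k).
  exact: norm_eq1.
have [pige|[m pim]] : (forall k, (k <= pi k)%N) \/ exists m, (pi m < m)%N.
  have [?|] := pselect (forall k, (k <= pi k)%N); first by left.
  by move=> /existsNP[m /negP]; rewrite -ltnNge => ?; right; exists m.
(* If [rho k < k], the induction hypothesis says that [pi] fixes [rho k], which it sends to [k]. *)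
- elim/ltn_ind: k => k IH; have := pige (rho k); rewrite pirho leq_eqVlt.
  by move=> /orP[/eqP rk|/[dup] rk /IH]; [rewrite -{1}rk|rewrite pirho => kr; rewrite -kr ltnn in rk].
(* Otherwise [rho] would map the [N + 1] indices up to [N] injectively into the [N] indices below
   [N]. *)
exfalso; have inf N : exists f, (N <= f)%N /\ (pi f <= f)%N.
  apply: contrapT => nf.
  have rhoN (j : 'I_N.+1) : (rho j < N)%N.
    rewrite ltnNge; apply/negP => Nrj; apply: nf; exists (rho j); split=> //.
    by rewrite pirho (leq_trans _ Nrj)// -ltnS.
  have /leq_card : injective (fun j : 'I_N.+1 => Ordinal (rhoN j)).
    by move=> i j /(congr1 val)/= /(congr1 pi); rewrite !pirho => /val_inj.
  by rewrite !card_ord ltnn.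
have far M N : exists f, [/\ (N <= f)%N, (pi f <= f)%N & (M <= pi f)%N].
  have [f [Nf pif]] := inf (maxn N (\max_(j < M) (rho j).+1)).
  exists f; split=> //; first by apply: leq_trans Nf; exact: leq_maxl.
  rewrite leqNgt; apply/negP => fM.
  have := leq_trans (leq_maxr _ _) Nf.
  rewrite leqNgt => /negP; apply.
  by apply: leq_trans (@leq_bigmax _ (fun j : 'I_M => (rho j).+1) (Ordinal fM)); rewrite /= rhopi.
pose P (B : {fset nat}) := [/\ m \in B, {in B, forall b, (m <= b)%N /\ (pi b <= b)%N}
  & {in B &, {homo pi : x y / (x < y)%N}}].
have Pm : P [fset m].
  split=> [|b|b c]; rewrite !inE//; first by move=> /eqP ->; rewrite leqnn ltnW.
  by move=> /eqP -> /eqP ->; rewrite ltnn.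
have [B n [mB Bb Bpi]|B [_ [mB Bb Bpi] [FB Bmax]]] := slike_extend hF (slike1 hF m) Pm.
  have [b0 Bb0] := fset_bound B; have [M BM] := fset_bound (pi @` B).
  have [f [nf pif Mf]] := far M (maxn n b0).
  have Bf : {in B, forall i, (i < f)%N}.
    by move=> i /Bb0 /leq_trans; apply; apply: leq_trans nf; exact: leq_maxr.
  exists f; split=> //; first by apply: leq_trans nf; exact: leq_maxl.
  split=> [|b|b c]; rewrite !inE; first by rewrite mB orbT.
    by move=> /orP[/eqP ->|/Bb//]; split=> //; rewrite ltnW// Bf.
  move=> /orP[/eqP->|bB] /orP[/eqP->|cB]; rewrite ?ltnn//.
  - by move=> /(ltn_trans (Bf _ cB)); rewrite ltnn.
  - by move=> _; apply: leq_trans Mf; apply: BM; apply/imfsetP; exists b.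
  - exact: Bpi.
have [k0 Bk0] := fset_bound B.
(* The image of [B] belongs to [F] and has the minimum [pi m < m], so one more point fits into [B],
   against maximality. *)
have FkB : F (k0 |` B).
  apply: (slike_dom_rcons hF (piF _ FB) _ _ mB _ pim Bk0) => [b bB|b c bB cB|b /Bb[]//].
    by split; [apply/imfsetP; exists b|have [] := Bb b bB].
  have [bc|cb|->] := ltngtP b c; last by rewrite ltnn.
    exact: Bpi.
  by apply/negbTE; rewrite -leqNgt ltnW// Bpi.
have kB := Bmax _ FkB (fsubsetUr _ _).
have /Bk0 : k0 \in B by rewrite -kB !inE eqxx.
by rewrite ltnn.
Qed.

End LinearIsometries.

Lemma powR_bernoulli_le1 {R : realType} (p v : R) : 1 <= p -> 0 <= v -> 1 + p * (v - 1) <= v `^ p.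
Proof.
rewrite le_eqVlt => /orP[/eqP <- v0|]; last exact: powR_bernoulli_le.
by rewrite powRr1// mul1r addrC subrK.
Qed.

(** * Metric characterization of the poles *)

Section Poles.
Context {R : realType} {F : set {fset nat}} (hF : schreier_like F) {p : R} (hp : 1 <= p).
Context {X : normedModType R} {e : nat -> X} {co : X -> nat -> R}
  (hX : schreier_space F p e co).
Implicit Types (x y : X) (A B : {fset nat}) (i j k : nat).

Let p0 : 0 < p. Proof. exact: lt_le_trans hp. Qed.
Let pn0 : p != 0. Proof. by rewrite gt_eqF. Qed.

Local Notation e0 := (e 0%N).
Local Notation offz := (off (e := e) (co := co) 0%N).

Lemma off0_id y : co y 0%N = 0 -> offz y = y.
Proof. by move=> y0; rewrite /off y0 scale0r subr0. Qed.

Lemma co_off0 x : co (offz x) 0%N = 0.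
Proof. by rewrite (co_off hX). Qed.

Lemma off0K x : co x 0%N *: e0 + offz x = x.
Proof. by rewrite addrC subrK. Qed.

Lemma off0_pole (s : R) y : co y 0%N = 0 ->
  co (s *: e0 + y) 0%N = s /\ offz (s *: e0 + y) = y.
Proof.
move=> y0; have cE : co (s *: e0 + y) 0%N = s.
  by rewrite (coD hX) (coZ hX) (co_e hX) eqxx mulr1 y0 addr0.
by split=> //; rewrite /off cE addrC addKr.
Qed.

(* [fset 0] is the only member of F containing 0. *)
Lemma norm_pole (s : R) y : co y 0%N = 0 -> `|s *: e0 + y| = Num.max `|s| `|y|.
Proof.
move=> y0; have [cs _] := off0_pole s y0.
apply/eqP; rewrite eq_le; apply/andP; split; last first.
  rewrite ge_max; apply/andP; split.
    by rewrite -{1}cs; exact: (co_le hF hp hX).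
  apply: (norm_co_le hp hX) => i; rewrite (coD hX) (coZ hX) (co_e hX).
  by case: eqP => [->|_]; rewrite ?y0 ?normr0 ?normr_ge0// mulr0 add0r.
have m0 : 0 <= Num.max `|s| `|y| by rewrite le_max normr_ge0.
apply: (norm_le hX) => // A FA.
have [A0|A0] := boolP (0%N \in A).
  by rewrite (slike0 hF FA A0) psum1 cs (ler_powR2 p0)// le_max lexx.
rewrite (@psum_eq _ _ _ (co y)) => [|i iA]; last first.
  rewrite (coD hX) (coZ hX) (co_e hX).
  by case: eqP iA A0 => [->->//|_ _ _]; rewrite mulr0 add0r.
apply: le_trans (psum_le_norm hX _ FA) _.
by rewrite (ler_powR2 p0)// le_max lexx orbT.
Qed.

Lemma dist_pole (s t : R) y z : co y 0%N = 0 -> co z 0%N = 0 ->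
  `|(s *: e0 + y) - (t *: e0 + z)| = Num.max `|s - t| `|y - z|.
Proof.
move=> y0 z0; rewrite opprD addrACA -scalerBl norm_pole//.
by rewrite (coB hX) y0 z0 subrr.
Qed.

(** For large [j] the pair of [i] and [j], a member of [F], collects the mass of [x] at [i] and
    almost all the mass of [e j]. *)
Lemma far_point x i (t : R) : (0 < i)%N -> co x i != 0 ->
  exists N, forall j, (N <= j)%N -> 1 < `|t *: e0 + e j - x|.
Proof.
move=> i0 xi; pose a := `|co x i| `^ p.
have a0 : 0 < a by rewrite powR_gt0// normr_gt0.
(* By Bernoulli (1 - r)^p >= 1 - p r >= 1 - a / 2, so the total is at least 1 + a / 2. *)
pose r := Num.min 1 (a / (2 * p)).
have r0 : 0 < r by rewrite lt_min ltr01 divr_gt0// mulr_gt0.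
have rp : p * r <= a / 2.
  apply: (@le_trans _ _ (p * (a / (2 * p)))).
    by rewrite ler_pM2l// ge_min lexx orbT.
  by rewrite mulrCA invfM [2^-1 * _]mulrC mulVKf.
have r1 : r <= 1 by rewrite ge_min lexx.
have [N xN] := co_cvg0 hF hp hX x r0.
exists (maxn N i.+1) => j; rewrite geq_max => /andP[/xN xj ij].
have j0 : (0 < j)%N by exact: leq_trans ij.
have Fij := slike2 hF i0 j0.
rewrite -(ltr_powR2 p0)// powR1; apply: lt_le_trans (psum_le_norm hX _ Fij).
have ji : i != j by rewrite ltn_eqF.
rewrite (psumD1 _ _ (_ : i \in _)) ?inE ?eqxx//.
have -> : [fset i; j] `\ i = [fset j].
  by apply/fsetP => l; rewrite !inE; case: eqVneq => [->|//]; rewrite (negbTE ji).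
rewrite psum1 !(coB hX) !(coD hX) !(coZ hX) !(co_e hX) eqxx (negbTE ji).
rewrite (gtn_eqF i0) (gtn_eqF j0) (_ : false%:R = 0 :> R)// mulr0 !add0r normrN.
have : (1 - r) `^ p <= `|1 - co x j| `^ p.
  rewrite (ler_powR2 p0)//; last lra.
  by have := ler_norm (1 - co x j); have := ler_norm (co x j); lra.
have := @powR_bernoulli_le1 _ p (1 - r) hp; rewrite -/a => /(_ _)/=.
lra.
Qed.

(** A purely metric relation on the sphere, hence preserved by surjective isometries. *)
Definition poles x x' := `|x - x'| = 2 /\
  forall y, `|y| = 1 -> `|y - x| <= 1 \/ `|y - x'| <= 1.

Lemma poles_sym x x' : poles x x' -> poles x' x.
Proof. by move=> [d h]; split=> [|y /h[]]; [rewrite distrC|right|left]. Qed.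

Lemma poles_e0 : poles e0 (- e0).
Proof.
split; first by rewrite opprK -mulr2n normrMn (norm_e hF hp hX).
move=> y y1.
have := co_le hF hp hX y 0; rewrite y1 ler_norml => /andP[s1 s2].
have oy : `|offz y| <= 1 by move: y1; rewrite -{1}(off0K y) norm_pole ?co_off0// => <-; rewrite le_max lexx orbT.
have z0 : co (0 : X) 0%N = 0 by rewrite (co0 hX).
have dE (t : R) : `|y - t *: e0| = Num.max `|co y 0%N - t| `|offz y|.
  by rewrite -{1}(off0K y) -[t *: e0]addr0 dist_pole ?co_off0// subr0.
have [s0|s0] := lerP 0 (co y 0%N); [left|right].
  by rewrite -[e0]scale1r dE ge_max oy andbT ler_norml; lra.
by rewrite -(scaleN1r e0) dE ge_max oy andbT ler_norml; lra.
Qed.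

Lemma off0_neq0 x : offz x != 0 -> exists2 i, (0 < i)%N & co x i != 0.
Proof.
move=> xn0; apply: contrapT => ni; move/eqP: xn0; apply.
apply: (co_inj hp hX) => i; rewrite (co_off hX) (co0 hX); case: eqP => // i0.
apply: contrapT => /eqP xi; apply: ni; exists i => //.
by rewrite lt0n; apply/eqP.
Qed.

Lemma poles_line x x' : `|x| = 1 -> `|x'| = 1 -> poles x x' -> offz x = 0 ->
  x = e0 /\ x' = - e0 \/ x = - e0 /\ x' = e0.
Proof.
move=> x1 x'1 [d h] ox.
have xE : x = co x 0%N *: e0 by rewrite -{1}(off0K x) ox addr0.
have s1 : `|co x 0%N| = 1.
  by move: x1; rewrite {1}xE normrZ (norm_e hF hp hX) mulr1.
set s := co x 0%N in xE s1 *.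
have z0 : co (0 : X) 0%N = 0 by rewrite (co0 hX).
have ox'1 : `|offz x'| <= 1.
  by rewrite -x'1 -{2}(off0K x') norm_pole ?co_off0// le_max lexx orbT.
have s'1 : `|co x' 0%N| <= 1 by rewrite -x'1; exact: (co_le hF hp hX).
have s'E : co x' 0%N = - s.
  move: d; rewrite xE -[s *: e0]addr0 -{1}(off0K x') dist_pole ?co_off0// sub0r normrN.
  case: (leP `|s - co x' 0%N| `|offz x'|) => _ d; first lra.
  move: s'1 d; rewrite ler_norml => /andP[? ?].
  by have [->|->] := norm_eq1 s1; case: (ger0P (_ - co x' 0%N)) => _; lra.
have [ox'|/off0_neq0[i i0 xi]] := eqVneq (offz x') 0.
  have -> : x' = - x by rewrite -(off0K x') ox' addr0 s'E scaleNr -xE.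
  have [s1'|s1'] := norm_eq1 s1; rewrite xE s1' ?scale1r ?scaleN1r ?opprK; by [left|right].
have [N xN] := far_point (- (s / 2)) i0 xi.
pose j := N.+1; have j0 : (0 < j)%N by [].
have ej0 : co (e j) 0%N = 0 by rewrite (co_e hX).
have [||] := h (- (s / 2) *: e0 + e j).
- rewrite norm_pole// (norm_e hF hp hX) normrN normrM s1 mul1r.
  by rewrite ger0_norm ?invr_ge0//; apply/max_idPr; rewrite invf_le1// ler1n.
- rewrite xE -[s *: e0]addr0 dist_pole// ge_max => /andP[+ _].
  have -> : - (s / 2) - s = - (s * (3 / 2)) by lra.
  by rewrite normrN normrM s1 mul1r ger0_norm ?divr_ge0// => ?; exfalso; lra.
- by rewrite leNgt xN.
Qed.

Lemma polesP x x' : `|x| = 1 -> `|x'| = 1 -> poles x x' ->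
  x = e0 /\ x' = - e0 \/ x = - e0 /\ x' = e0.
Proof.
move=> x1 x'1 xx'; have [|/off0_neq0[i i0 xi]] := eqVneq (offz x) 0.
  exact: poles_line.
have [|/off0_neq0[i' i'0 xi']] := eqVneq (offz x') 0.
  by move=> /(poles_line x'1 x1 (poles_sym xx'))[[-> ->]|[-> ->]]; [right|left].
have [N xN] := far_point 0 i0 xi; have [N' xN'] := far_point 0 i'0 xi'.
have [_ h] := xx'.
(* One basis vector, taken far enough, is at distance more than 1 from both points. *)
have [||] := h (e (maxn N N')); first exact: (norm_e hF hp hX).
  by have := xN _ (leq_maxl N N'); rewrite scale0r add0r ltNge => /negP.
by have := xN' _ (leq_maxr N N'); rewrite scale0r add0r ltNge => /negP.
Qed.

Definition sphere_isometry (T T' : X -> X) :=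
  bij_isometry (unit_sphere X) (unit_sphere X) T T'.

Lemma sphere_isometry_pole T T' : sphere_isometry T T' ->
  exists2 t : R, `|t| = 1 & T e0 = t *: e0 /\ T (- e0) = - t *: e0.
Proof.
move=> TT; have ne : `|e0| = 1 by exact: (norm_e hF hp hX).
have nN : `|- e0| = 1 by rewrite normrN.
have [d h] := poles_e0.
have : poles (T e0) (T (- e0)).
  split; first by rewrite (bij_isom_dist TT).
  move=> y y1; have Ty := bij_isom_fun' TT y1.
  rewrite -(bij_isomK' TT y1) !(bij_isom_dist TT)//.
  exact: h Ty.
have T1 x : `|x| = 1 -> `|T x| = 1 by move=> x1; exact: (bij_isom_fun TT).
move=> /(polesP (T1 _ ne) (T1 _ nN))[[-> ->]|[-> ->]].
  by exists 1; rewrite ?normr1// scale1r scaleN1r.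
by exists (-1); rewrite ?normrN ?normr1// opprK scale1r scaleN1r.
Qed.

End Poles.

(** * The linear isometry attached to a pole-fixing isometry *)

Section PoleFixing.
Context {R : realType} {F : set {fset nat}} (hF : schreier_like F) {p : R} (hp : 1 <= p).
Context {X : normedModType R} {e : nat -> X} {co : X -> nat -> R}
  (hX : schreier_space F p e co).
Implicit Types (x y : X) (A B : {fset nat}) (i j k : nat) (T : X -> X).

Let p0 : 0 < p. Proof. exact: lt_le_trans hp. Qed.
Let pn0 : p != 0. Proof. by rewrite gt_eqF. Qed.

Local Notation e0 := (e 0%N).
Local Notation offz := (off (e := e) (co := co) 0%N).

Record pole_isometry T T' : Prop := PoleIsometry {
  pole_isom : sphere_isometry T T';
  pole_fix : T e0 = e0;
  pole_fixN : T (- e0) = - e0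
}.

Lemma pole_isometry_sym T T' : pole_isometry T T' -> pole_isometry T' T.
Proof.
have ne : `|e0| = 1 by exact: (norm_e hF hp hX).
move=> [TT Te TNe]; split; first exact: bij_isometry_sym.
  by rewrite -{1}Te (bij_isomK TT).
by rewrite -{1}TNe (bij_isomK TT)//=; rewrite /unit_sphere/= normrN.
Qed.

(** Conjugation by -1 exchanges the two faces, so results on the face at [e0] transfer to the face
    at [- e0]. *)
Lemma pole_isometry_opp T T' : pole_isometry T T' ->
  pole_isometry (fun x => - T (- x)) (fun x => - T' (- x)).
Proof.
move=> [[TS T'S TK TK' Td] Te TNe].
have oS x : unit_sphere X x -> unit_sphere X (- x) by rewrite /unit_sphere/= normrN.
split; last 2 first.
- by rewrite TNe opprK.
- by rewrite opprK Te.
split.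
- by move=> x /oS/TS/oS.
- by move=> x /oS/T'S/oS.
- by move=> x xS; rewrite opprK TK ?opprK//; exact: oS.
- by move=> x xS; rewrite opprK TK' ?opprK//; exact: oS.
- move=> x y /oS xS /oS yS; rewrite -opprD normrN Td//.
  by rewrite -opprD normrN.
Qed.

Lemma norm_off0_le x : `|offz x| <= `|x|.
Proof.
by rewrite -{2}(off0K (e := e) (co := co) x) (norm_pole hF hp hX) ?co_off0// ?le_max ?lexx ?orbT//;
  exact: (co_off0 hX).
Qed.

(** The truncation at 1 hides [offz x], whose norm is at most 1. A negative coordinate 0 shows in
    the distance to [e0], a positive one in the distance to [- e0]; together they determine it. *)
Lemma dist_e0 x : `|x| = 1 -> Num.max 1 `|x - e0| = Num.max 1 (1 - co x 0%N).
Proof.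
move=> x1; have z0 : co (0 : X) 0%N = 0 by rewrite (co0 hX).
have ox := norm_off0_le x; rewrite x1 in ox.
have := co_le hF hp hX x 0; rewrite x1 ler_norml => /andP[s1 s2].
have := dist_pole hF hp hX (co x 0%N) 1 (co_off0 hX x) z0.
rewrite off0K scale1r addr0 subr0 => ->; rewrite distrC ger0_norm ?subr_ge0//.
by case: (leP (1 - co x 0%N) `|offz x|) => h; apply/eqP; rewrite eq_le !ge_max !le_max; lra.
Qed.

Lemma dist_Ne0 x : `|x| = 1 -> Num.max 1 `|x + e0| = Num.max 1 (1 + co x 0%N).
Proof.
move=> x1; have := @dist_e0 (- x); rewrite normrN => /(_ x1).
by rewrite -opprD normrN (coN hX) opprK.
Qed.

Lemma pole_isometry_co0 T T' x : pole_isometry T T' -> `|x| = 1 -> co (T x) 0%N = co x 0%N.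
Proof.
move=> [TT Te TNe] x1; have Tx1 : `|T x| = 1 by exact: (bij_isom_fun TT).
have ne : `|e0| = 1 by exact: (norm_e hF hp hX).
have nNe : `|- e0| = 1 by rewrite normrN.
have d1 : `|T x - e0| = `|x - e0| by rewrite -{1}Te (bij_isom_dist TT).
have d2 : `|T x + e0| = `|x + e0|.
  by rewrite -[e0]opprK -{1}TNe (bij_isom_dist TT).
have := dist_e0 Tx1; rewrite d1 dist_e0//.
have := dist_Ne0 Tx1; rewrite d2 dist_Ne0//.
have := co_le hF hp hX x 0; rewrite x1 ler_norml => /andP[? ?].
have := co_le hF hp hX (T x) 0; rewrite Tx1 ler_norml => /andP[? ?].
case: (leP 1 (1 + co x 0%N)) => ?; case: (leP 1 (1 + co (T x) 0%N)) => ?;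
case: (leP 1 (1 - co x 0%N)) => ?; case: (leP 1 (1 - co (T x) 0%N)) => ?; lra.
Qed.

(** Keeps the coordinate 0 and acts on the rest as [T] does on the face at [e0]. This is an isometry
    of the unit ball of X itself, so the Mazur-Ulam argument needs no separate space for the
    complement of the line. *)
Definition pole_map T x := co x 0%N *: e0 + (T (e0 + offz x) - e0).

Lemma norm_e0_add y : co y 0%N = 0 -> `|y| <= 1 -> `|e0 + y| = 1.
Proof.
by move=> y0 y1; rewrite -[e0]scale1r (norm_pole hF hp hX)// normr1; apply/max_idPl.
Qed.

Lemma co_e0_add y : co y 0%N = 0 -> co (e0 + y) 0%N = 1.
Proof. by move=> y0; rewrite (coD hX) (co_e hX) eqxx y0 addr0. Qed.

Lemma off0_pole_map T T' x : pole_isometry T T' -> `|x| <= 1 ->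
  [/\ co (pole_map T x) 0%N = co x 0%N, e0 + offz (pole_map T x) = T (e0 + offz x)
    & `|pole_map T x| <= 1].
Proof.
move=> pT x1; have ox0 := co_off0 hX x.
have ox1 : `|offz x| <= 1 by exact: le_trans (norm_off0_le x) x1.
have eo1 := norm_e0_add ox0 ox1.
have Te0 : co (T (e0 + offz x) - e0) 0%N = 0.
  by rewrite (coB hX) (pole_isometry_co0 pT)// co_e0_add// (co_e hX) eqxx subrr.
have [c1 c2] := off0_pole hX (co x 0%N) Te0.
split=> //; first by rewrite /pole_map c2 addrC subrK.
rewrite (norm_pole hF hp hX)// ge_max; apply/andP; split.
  exact: le_trans (co_le hF hp hX x 0) x1.
rewrite -{2}(pole_fix pT) (bij_isom_dist (pole_isom pT))//; last exact: (norm_e hF hp hX).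
by rewrite addrC addKr.
Qed.

Lemma pole_map_isometry T T' : pole_isometry T T' ->
  bij_isometry (@unit_ball R X) (@unit_ball R X) (pole_map T) (pole_map T').
Proof.
move=> pT; have pT' := pole_isometry_sym pT.
have K T1 T1' : pole_isometry T1 T1' -> forall x, `|x| <= 1 ->
    pole_map T1' (pole_map T1 x) = x.
  move=> pT1 x x1; have [c1 c2 _] := off0_pole_map pT1 x1.
  rewrite /pole_map -/(pole_map T1 x) c1 c2 (bij_isomK (pole_isom pT1)).
    by rewrite [e0 + _]addrC addrK off0K.
  apply: norm_e0_add; first exact: (co_off0 hX).
  exact: le_trans (norm_off0_le x) x1.
have addKl (a b c : X) : (c + a) - (c + b) = a - b.
  by rewrite opprD addrACA subrr add0r.
split.
- by move=> x /(off0_pole_map pT)[].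
- by move=> x /(off0_pole_map pT')[].
- exact: K.
- exact: K.
- move=> x y x1 y1; have [c1 c2 _] := off0_pole_map pT x1.
  have [d1 d2 _] := off0_pole_map pT y1.
  have ox := le_trans (norm_off0_le x) x1; have oy := le_trans (norm_off0_le y) y1.
  rewrite -{1}(off0K (e := e) (co := co) (pole_map T x)) -{1}(off0K (e := e) (co := co) (pole_map T y)).
  rewrite (dist_pole hF hp hX) ?(co_off0 hX)// c1 d1.
  have -> : `|offz (pole_map T x) - offz (pole_map T y)| = `|offz x - offz y|.
    have -> : offz (pole_map T x) - offz (pole_map T y) = T (e0 + offz x) - T (e0 + offz y).
      by rewrite -c2 -d2 addKl.
    rewrite (bij_isom_dist (pole_isom pT)).
    - by rewrite addKl.
    - by apply: norm_e0_add; rewrite ?(co_off0 hX).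
    - by apply: norm_e0_add; rewrite ?(co_off0 hX).
  by rewrite -(dist_pole hF hp hX) ?(co_off0 hX)// !off0K.
Qed.

Lemma pole_isometry_linear T T' : pole_isometry T T' ->
  exists g h : {linear X -> X}, exists theta : nat -> R,
    [/\ lin_isometry g h, g e0 = e0, forall k, theta k = 1 \/ theta k = -1,
        forall x k, co (g x) k = theta k * co x k
      & forall y, co y 0%N = 0 -> `|y| <= 1 -> T (e0 + y) = e0 + g y].
Proof.
move=> pT; have pT' := pole_isometry_sym pT.
have z0 : co (0 : X) 0%N = 0 by rewrite (co0 hX).
have m0 T1 T1' : pole_isometry T1 T1' -> pole_map T1 0 = 0.
  move=> pT1; rewrite /pole_map z0 scale0r add0r.
  by rewrite /off z0 scale0r subr0 addr0 (pole_fix pT1) subrr.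
have [g [gf gn]] := ball_isometry_linear (pole_map_isometry pT) (m0 _ _ pT).
have [h [hf hn]] := ball_isometry_linear (pole_map_isometry pT') (m0 _ _ pT').
have scale (g1 h1 : {linear X -> X}) : (forall x, `|x| <= 1 -> h1 (g1 x) = x) ->
    forall x, h1 (g1 x) = x.
  move=> H x; have a0 : 0 < `|x| + 1 by rewrite ltr_wpDl.
  have -> : x = (`|x| + 1) *: ((`|x| + 1)^-1 *: x).
    by rewrite scalerA mulfV ?gt_eqF// scale1r.
  rewrite linearZ linearZ/= H// normrZ gtr0_norm ?invr_gt0//.
  by rewrite mulrC ler_pdivrMr// mul1r lerDl.
have gh : lin_isometry g h.
  split=> //; apply: scale => x x1.
    by rewrite gf// hf; [rewrite (bij_isomK (pole_map_isometry pT))|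
      exact: (bij_isom_fun (pole_map_isometry pT))].
  by rewrite hf// gf; [rewrite (bij_isomK' (pole_map_isometry pT))|
      exact: (bij_isom_fun' (pole_map_isometry pT))].
have ne : `|e0| = 1 by exact: (norm_e hF hp hX).
have pe T1 T1' (g1 : {linear X -> X}) : pole_isometry T1 T1' ->
    (forall x, `|x| <= 1 -> g1 x = pole_map T1 x) ->
    g1 e0 = 1 *: e0 /\ forall x, co (g1 x) 0%N = 1 * co x 0%N.
  move=> pT1 g1f; split.
    rewrite g1f ?ne// /pole_map (co_e hX) eqxx scale1r.
    by rewrite /off (co_e hX) eqxx scale1r subrr addr0 (pole_fix pT1) subrr addr0.
  move=> x; have a0 : 0 < `|x| + 1 by rewrite ltr_wpDl.
  have -> : x = (`|x| + 1) *: ((`|x| + 1)^-1 *: x).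
    by rewrite scalerA mulfV ?gt_eqF// scale1r.
  rewrite linearZ !(coZ hX) mul1r; congr (_ * _).
  have x1 : `|(`|x| + 1)^-1 *: x| <= 1.
    rewrite normrZ gtr0_norm ?invr_gt0//.
    by rewrite mulrC ler_pdivrMr// mul1r lerDl.
  by rewrite g1f//; have [-> _ _] := off0_pole_map pT1 x1; rewrite (coZ hX).
have [ge0 gc0] := pe _ _ _ pT gf; have [he0 hc0] := pe _ _ _ pT' hf.
have hg := lin_isometry_sym gh.
have n1 : `|1 : R| = 1 by rewrite normr1.
have [sg sh] : signed_basis (e := e) g /\ signed_basis (e := e) h.
  have [p1|p1] := ltP 1 p.
    by split; [exact: (signed_basis_gt1 hF hp hX p1 gh)|exact: (signed_basis_gt1 hF hp hX p1 hg)].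
  have {}p1 : p = 1 by apply/eqP; rewrite eq_le p1 hp.
  by split; [exact: (signed_basis_1 hF hp hX p1 hg n1)|exact: (signed_basis_1 hF hp hX p1 gh n1)].
have [theta [th1 thE]] := signed_basis_diag hF hp hX gh sg sh.
exists g, h, theta; split=> //; first by rewrite ge0 scale1r.
move=> y y0 y1.
by rewrite gf// /pole_map y0 scale0r add0r (off0_id y0) [RHS]addrC subrK.
Qed.

End PoleFixing.

(** * Rigidity under truncated distances *)

Lemma max_eq_inv {R : realType} (d a b : R) : d < a -> Num.max d a = Num.max d b -> b = a.
Proof. by rewrite !maxEle; case: ifP; case: ifP; lra. Qed.

Lemma max_eq_lt {R : realType} (d a b c : R) : d < a -> b < a ->
  Num.max d b = Num.max d c -> c < a.
Proof. by rewrite !maxEle; case: ifP; case: ifP; lra. Qed.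

Lemma max_eq_le {R : realType} (q d a b : R) : q <= d ->
  Num.max q a = Num.max q b -> Num.max d a = Num.max d b.
Proof. by rewrite !maxEle; do 4! case: ifP; lra. Qed.

Section Rigidity.
Context {R : realType} {F : set {fset nat}} (hF : schreier_like F) {p : R} (hp : 1 <= p).
Context {X : normedModType R} {e : nat -> X} {co : X -> nat -> R}
  (hX : schreier_space F p e co).
Implicit Types (x y z w : X) (A B M : {fset nat}) (i j k : nat) (T : X -> X).

Let p0 : 0 < p. Proof. exact: lt_le_trans hp. Qed.
Let pn0 : p != 0. Proof. by rewrite gt_eqF. Qed.

Local Notation e0 := (e 0%N).
Local Notation offz := (off (e := e) (co := co) 0%N).

Lemma co_addZe x a i k : co (x + a *: e i) k = co x k + (if k == i then a else 0).
Proof. by rewrite (coD hX) (coZ hX) (co_e hX); case: eqP => _; rewrite ?mulr1 ?mulr0. Qed.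

(** Compare a set norming [x - e i] with the best set through [i]. If it contains [i], the entry |t
    - 1| is smaller than 1 + t; if not, its sum is at most 1, less than (1 + t)^p. The sign of a
    coordinate is thus visible in the distances to [e i] and [- e i]. *)
Lemma norm_add_e_lt x i : `|x| <= 1 -> 0 < co x i -> `|x - e i| < `|x + e i|.
Proof.
move=> x1 xi; set t := co x i in xi.
have [A [FA iA Amax]] := psum_attained_at hF hp hX x i.
have ps (s : R) C : psum p (co (x + s *: e i)) (C `\ i) = psum p (co x) (C `\ i).
  by apply: psum_eq => k; rewrite !inE co_addZe => /andP[/negbTE -> _]; rewrite addr0.
have ge : (1 + t) `^ p + psum p (co x) (A `\ i) <= `|x + e i| `^ p.
  rewrite -[e i]scale1r; apply: le_trans (psum_le_norm hX _ FA).
  rewrite (psumD1 _ _ iA) ps co_addZe eqxx ger0_norm ?[1 + t]addrC//.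
  by rewrite addr_ge0// ltW.
have t1 : 1 < (1 + t) `^ p.
  have p1E : 1 `^ p = 1 :> R by rewrite powR1.
  by rewrite -{1}p1E (ltr_powR2 p0)//; lra.
have [B FB Bn] := norm_attained hF hp hX (x - e i).
rewrite -(ltr_powR2 p0)// -Bn; apply: lt_le_trans ge.
have [iB|iB] := boolP (i \in B).
  rewrite -scaleN1r (psumD1 _ _ iB) ps; apply: ltr_leD; last exact: Amax.
  rewrite (ltr_powR2 p0)//; last lra.
  rewrite co_addZe eqxx -/t; have := co_le hF hp hX x i; rewrite -/t ltr_norml.
  by rewrite gtr0_norm//; lra.
rewrite (@psum_eq _ _ _ (co x)) => [|k kB]; last first.
  rewrite -scaleN1r co_addZe; case: eqP => [ki|_]; last by rewrite addr0.
  by rewrite -ki kB in iB.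
apply: le_lt_trans (psum_le1 hp hX x1 FB) _.
by rewrite (lt_le_trans t1)// lerDl psum_ge0.
Qed.

Lemma norm_add_e_eq x i : co x i = 0 -> `|x - e i| = `|x + e i|.
Proof.
move=> xi; apply: (norm_co_eq hp hX) => k.
rewrite -scaleN1r -{2}[e i]scale1r !co_addZe; case: eqP => [->|_]//.
by rewrite xi !add0r normrN.
Qed.

Lemma norm_add_e_gt x i : `|x| <= 1 -> co x i < 0 -> `|x + e i| < `|x - e i|.
Proof.
move=> x1 xi; have := @norm_add_e_lt (- x) i.
rewrite normrN (coN hX) oppr_gt0 => /(_ x1 xi).
by rewrite -(normrN (x + e i)) -(normrN (x - e i)) opprD opprB [e i - x]addrC.
Qed.

(** The i-th coordinate is replaced by the value of sign [s] that saturates the best set through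
    [i]; this turns [w] into a unit test vector. *)
Lemma fill_at w i (s : R) : `|w| <= 1 -> `|s| = 1 ->
  exists A a, [/\ F A, i \in A, 0 <= a, a `^ p + psum p (co w) (A `\ i) = 1
    & `|off (e := e) (co := co) i w + (s * a) *: e i| = 1].
Proof.
move=> w1 s1; have [A [FA iA Amax]] := psum_attained_at hF hp hX w i.
have le1 : psum p (co w) (A `\ i) <= 1.
  by apply: le_trans (psum_le1 hp hX w1 FA); apply: psum_sub; exact: fsubD1set.
pose a := (1 - psum p (co w) (A `\ i)) `^ p^-1.
have a0 : 0 <= a by exact: powR_ge0.
have aE : a `^ p = 1 - psum p (co w) (A `\ i) by rewrite powR_invK// subr_ge0.
pose z := off (e := e) (co := co) i w + (s * a) *: e i.
have coz k : co z k = if k == i then s * a else co w k.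
  by rewrite /z co_addZe (co_off hX); case: eqP => _; rewrite ?add0r ?addr0.
have pz C : psum p (co z) (C `\ i) = psum p (co w) (C `\ i).
  by apply: psum_eq => k; rewrite !inE coz => /andP[/negbTE ->].
have pzi C : i \in C -> psum p (co z) C = a `^ p + psum p (co w) (C `\ i).
  by move=> iC; rewrite (psumD1 _ _ iC) pz coz eqxx normrM s1 mul1r ger0_norm.
exists A, a; split=> //; first by rewrite aE subrK.
apply/eqP; rewrite eq_le; apply/andP; split.
  apply: (norm_le1 hX) => B FB; have [iB|iB] := boolP (i \in B).
    by rewrite pzi// aE; have := Amax B FB iB; lra.
  rewrite (@psum_eq _ _ _ (co w)); first exact: (psum_le1 hp hX).
  by move=> k kB; rewrite coz; case: eqP kB iB => // -> ->.
rewrite -(ler_powR2 p0)// powR1; apply: le_trans (psum_le_norm hX z FA).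
by rewrite pzi// aE subrK.
Qed.

(* y and y' are indistinguishable by their distances, as far as these exceed d,
   to the unit vectors supported on M; s is their common sign pattern. *)
Record twins M (d : R) (s : nat -> R) y y' : Prop := Twins {
  twins1 : `|y| = 1;
  twins1' : `|y'| = 1;
  twins0 : co y 0%N = 0;
  twins_supp : forall i, i \notin M -> co y i = 0;
  twins_eq0 : forall i, co y i = 0 <-> co y' i = 0;
  twins_s : forall i, `|s i| = 1;
  twins_sg : forall i, co y i = s i * `|co y i|;
  twins_sg' : forall i, co y' i = s i * `|co y' i|;
  twins_d : `|y - y'| <= d;
  twins_dist : forall z, (forall i, i \notin M -> co z i = 0) -> co z 0%N = 0 ->
    `|z| = 1 -> Num.max d `|y - z| = Num.max d `|y' - z|
}.

Lemma twins_sym M d s y y' : twins M d s y y' -> twins M d s y' y.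
Proof.
move=> [y1 y'1 y0 yM yy' s1 ys y's yd H]; split=> //.
- exact/yy'.
- by move=> i /yM/yy'.
- by move=> i; split=> /yy'.
- by rewrite distrC.
- by move=> z zM z0 z1; rewrite H.
Qed.

(** The test vector [z] is [y] with its i-th coordinate replaced by one of opposite sign and size
    [a >= t]. Then [y - z] is a multiple of [e i] of norm [t + a >= 2 * t > d], a distance that the
    truncation does not hide, whereas [y' - z] has norm at least [t' + a]. *)
Lemma twins_big M d s y y' i : twins M d s y y' -> 0 <= d -> d < 2 * `|co y i| ->
  `|co y' i| <= `|co y i|.
Proof.
move=> tw d0 di; set t := `|co y i| in di *; set t' := `|co y' i|.
have t0 : 0 <= t by exact: normr_ge0.
have t'0 : 0 <= t' by exact: normr_ge0.
have yi : co y i != 0 by rewrite -normr_gt0 -/t; lra.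
have iM : i \in M by apply: contraNT yi => /(twins_supp tw) ->.
have i0 : i != 0%N by apply: contraNneq yi => ->; rewrite (twins0 tw).
have s1 := twins_s tw i.
have sN1 : `|- s i| = 1 by rewrite normrN.
have y1 : `|y| <= 1 by rewrite (twins1 tw).
have [A [a [FA iA a0 aE z1]]] := fill_at i y1 sN1.
set z := _ + _ in z1.
have coz k : co z k = if k == i then - s i * a else co y k.
  by rewrite /z co_addZe (co_off hX); case: eqP => _; rewrite ?add0r ?addr0.
have ta : t <= a.
  rewrite -(ler_powR2 p0)//; have := psum_le1 hp hX y1 FA.
  by rewrite (psumD1 _ _ iA) -/t; lra.
have yz : `|y - z| = t + a.
  have -> : y - z = (s i * (t + a)) *: e i.
    apply: (co_inj hp hX) => k; rewrite (coB hX) coz (coZ hX) (co_e hX).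
    case: eqP => [->|_]; last by rewrite subrr mulr0.
    by rewrite (twins_sg tw) mulr1 -/t mulNr opprK mulrDr.
  by rewrite normrZ normrM s1 mul1r (norm_e hF hp hX) mulr1 ger0_norm// addr_ge0// normr_ge0.
have y'z : t' + a <= `|y' - z|.
  apply: le_trans (co_le hF hp hX _ i); rewrite (coB hX) coz eqxx (twins_sg' tw) -/t'.
  by rewrite mulNr opprK -mulrDr normrM s1 mul1r ler_norm.
have := twins_dist tw (z := z); rewrite yz.
have -> : Num.max d (t + a) = t + a by apply/max_idPr; lra.
move=> H; have : `|y' - z| <= t + a.
  rewrite H ?le_max ?lexx ?orbT//; last by rewrite coz eq_sym (negbTE i0) (twins0 tw).
  move=> k kM; rewrite coz; case: eqP => [ki|_]; first by rewrite ki iM in kM.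
  exact: twins_supp tw _ kM.
lra.
Qed.

(* Coordinates too small for [twins_big]: the test vector cancels them,
   except the i-th one, and halves the large coordinates, on which y and y'
   are already known to agree. *)
Lemma twins_small M d s y y' i : twins M d s y y' -> 0 < d -> 8 * d * #|` M|%:R <= 1 ->
  (forall k, 2 * d < `|co y k| -> co y' k = co y k) ->
  `|co y i| <= 2 * d -> `|co y' i| <= `|co y i|.
Proof.
move=> tw d0 dM big di; set t := `|co y i| in di *; set t' := `|co y' i|.
have t0 : 0 <= t by exact: normr_ge0.
have t'0 : 0 <= t' by exact: normr_ge0.
have [yi|yi] := eqVneq (co y i) 0.
  by rewrite /t' ((twins_eq0 tw i).1 yi) normr0 normr_ge0.
have iM : i \in M by apply: contraNT yi => /(twins_supp tw) ->.
have i0 : i != 0%N by apply: contraNneq yi => ->; rewrite (twins0 tw).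
have M1 : 1 <= #|` M|%:R :> R.
  by rewrite ler1n cardfs_gt0; apply/fset0Pn; exists i.
have d1 : d <= 8^-1.
  have := ler_wpM2l (ltW d0) M1; lra.
have s1 := twins_s tw i.
have sN1 : `|- s i| = 1 by rewrite normrN.
pose small k := `|co y k| <= 2 * d.
pose w := fin_sum e (fun k => if small k then co y k else co y k / 2) M.
pose v := fin_sum e (fun k => if small k then 0 else co y k / 2) M.
have cow k : co w k = if small k then co y k else co y k / 2.
  rewrite (co_fin_sum hX); case: ifPn => // /(twins_supp tw) ->.
  by rewrite mul0r if_same.
have cov k : co v k = if small k then 0 else co y k / 2.
  rewrite (co_fin_sum hX); case: ifPn => // /(twins_supp tw) ->.
  by rewrite mul0r if_same.
have half (r : R) : `|r / 2| <= `|r|.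
  have h2 : `|2^-1 : R| = 2^-1 by rewrite ger0_norm ?invr_ge0.
  by rewrite normrM h2; have := normr_ge0 r; lra.
have w1 : `|w| <= 1.
  rewrite -(twins1 tw); apply: (norm_co_le hp hX) => k; rewrite cow; case: ifP => _ //.
have [A [a [FA iA a0 aE z1]]] := fill_at i w1 sN1.
set z := _ + _ in z1.
have coz k : co z k = if k == i then - s i * a else co w k.
  by rewrite /z co_addZe (co_off hX); case: eqP => _; rewrite ?add0r ?addr0.
have [A2 [FA2 iA2 A2max]] := psum_attained_at hF hp hX v i.
set V := psum p (co v) (A2 `\ i) in A2max.
pose u k := if small k then co y k else 0.
(* Each small coordinate contributes at most (2 d)^p <= 2 d; the constant 8 in the hypothesis makes
   their total at most 1/4. *)
have wle : psum p (co w) (A `\ i) <= psum p (co v) (A `\ i) + #|` M|%:R * (2 * d).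
  rewrite (@psum_eq _ _ _ (co v \+ u)) => [|k _]; last first.
    by rewrite /= cow cov /u; case: ifP; rewrite ?addr0 ?add0r.
  rewrite psumD// => [|k _]; last by rewrite cov /u; case: ifP; [left|right].
  rewrite lerD2l; apply: (@le_trans _ _ (psum p u M)).
    apply: psum_supp_le => // k _; rewrite /u; apply: contraNT => /(twins_supp tw) ->.
    by rewrite if_same.
  apply: (@le_trans _ _ (\sum_(k <- M) 2 * d)).
    apply: ler_sum => k _; apply: (@le_trans _ _ ((2 * d) `^ p)).
      rewrite (ler_powR2 p0)//; last lra.
      by rewrite /u; case: ifPn => // _; rewrite normr0; lra.
    by apply: ge1r_powR => //; lra.
  by rewrite big_const_seq count_predT iter_addr_0 -[leLHS]mulr_natl.
have vle := A2max A FA iA.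
have ta0 : 0 <= t + a by rewrite addr_ge0// /t.
have a_le : a `^ p <= (t + a) `^ p by rewrite (ler_powR2 p0)// lerDr /t.
have Q34 : 3 / 4 <= (t + a) `^ p + V.
  have : #|` M|%:R * (2 * d) <= 4^-1 by lra.
  lra.
have coyz k : co (y - z) k = if k == i then s i * (t + a) else co v k.
  rewrite (coB hX) coz; case: eqP => [->|_].
    by rewrite (twins_sg tw) -/t mulNr opprK mulrDr.
  by rewrite cow cov; case: ifP => _; rewrite ?subrr//; lra.
have V0 : 0 <= V by exact: psum_ge0.
(* A set that avoids [i] sees at most one half of each coordinate of [y], hence a sum of at most
   1/2, which is below the 3/4 of [Q34]. *)
have yz : `|y - z| `^ p <= (t + a) `^ p + V.
  have [B FB <-] := norm_attained hF hp hX (y - z).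
  have [iB|iB] := boolP (i \in B).
    rewrite (psumD1 _ _ iB) coyz eqxx normrM s1 mul1r ger0_norm// lerD2l.
    rewrite (@psum_eq _ _ _ (co v)) => [|k]; first exact: A2max.
    by rewrite !inE coyz => /andP[/negbTE ->].
  apply: le_trans Q34.
  apply: (@le_trans _ _ (2^-1 * psum p (co y) B)).
    apply: (@le_trans _ _ (psum p (fun k => 2^-1 * co y k) B)).
      apply: psum_le => [|k kB]; first exact: ltW.
      rewrite coyz; case: eqP => [ki|_]; first by rewrite ki (negbTE iB) in kB.
      by rewrite cov mulrC; case: ifP => // _; rewrite normr0.
    rewrite psumZ ler_wpM2r ?psum_ge0// ger0_norm ?invr_ge0//.
    by apply: ge1r_powR => //; lra.
  have y1 : `|y| <= 1 by rewrite (twins1 tw).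
  have := psum_le1 hp hX y1 FB; lra.
have y'z : (t' + a) `^ p + V <= `|y' - z| `^ p.
  apply: le_trans (psum_le_norm hX _ FA2); rewrite (psumD1 _ _ iA2).
  rewrite lerD//.
    rewrite (coB hX) coz eqxx (twins_sg' tw) -/t' mulNr opprK -mulrDr normrM s1 mul1r.
    by rewrite ger0_norm// addr_ge0// /t'.
  apply: psum_le => [|k]; first exact: ltW.
  rewrite !inE => /andP[/negbTE ki _]; rewrite (coB hX) coz ki cow cov.
  rewrite /small; case: (leP `|co y k| (2 * d)) => [_|dk]; first by rewrite normr0.
  rewrite (big _ dk).
  have -> : co y k - co y k / 2 = co y k / 2 by lra.
  by [].
rewrite leNgt; apply/negP => tt'.
have lt1 : (t + a) `^ p < (t' + a) `^ p by rewrite (ltr_powR2 p0)//; lra.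
have yy' : `|y - z| < `|y' - z| by rewrite -(ltr_powR2 p0)//; lra.
(* The distance escapes the truncation, as d^p <= d <= 1/8 < 3/4. *)
have dy' : d < `|y' - z|.
  rewrite -(ltr_powR2 p0)//; last exact: ltW.
  have : d `^ p <= d by apply: ge1r_powR => //; lra.
  lra.
have := twins_dist tw (z := z) _ _ z1.
have -> : Num.max d `|y' - z| = `|y' - z| by apply/max_idPr; exact: ltW.
move=> H; have : Num.max d `|y - z| = `|y' - z|.
  apply: H; last by rewrite coz eq_sym (negbTE i0) cow (twins0 tw) mul0r if_same.
  move=> k kM; rewrite coz cow (twins_supp tw kM) mul0r if_same.
  by case: eqP => // ki; rewrite ki iM in kM.
by case: leP => _ h; lra.
Qed.

(** The signs being common, only absolute values matter. The threshold 2 d makes [twins_big] usable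
    in both directions: the corresponding coordinate of the twin, at distance at most d, still
    exceeds d. *)
Lemma twins_eq M d s y y' : twins M d s y y' -> 0 < d -> 8 * d * #|` M|%:R <= 1 -> y = y'.
Proof.
move=> tw d0 dM.
have close x x' k : twins M d s x x' -> `|co x k| - d <= `|co x' k|.
  move=> tw'; have := co_le hF hp hX (x - x') k; rewrite (coB hX).
  have := twins_d tw'; have := ler_distD (co x' k) (co x k) 0; rewrite !subr0; lra.
have big x x' : twins M d s x x' -> forall k, 2 * d < `|co x k| -> co x' k = co x k.
  move=> tw' k dk; rewrite (twins_sg tw') (twins_sg' tw'); congr (_ * _).
  apply/eqP; rewrite eq_le (twins_big tw')//=; [|exact: ltW|lra].
  apply: twins_big (twins_sym tw') _ _; first exact: ltW.
  by have := close _ _ k tw'; lra.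
have le x x' : twins M d s x x' -> forall k, `|co x' k| <= `|co x k|.
  move=> tw' k; have [dk|dk] := leP `|co x k| (2 * d).
    exact: twins_small tw' d0 dM (big _ _ tw') dk.
  by rewrite (big _ _ tw').
apply: (co_inj hp hX) => k; rewrite (twins_sg tw) (twins_sg' tw); congr (_ * _).
by apply/eqP; rewrite eq_le (le _ _ tw) (le _ _ (twins_sym tw)).
Qed.

(** Signs are read off the test vectors [e i] and [- e i]: the larger of the two distances from [y]
    is at least 1 > d, so its value and its order relative to the other survive the truncation. The
    test vector [y] itself bounds the distance between the twins. *)
Lemma twinsP m M (d : R) y y' : 0 < d -> d < 1 -> (0 < m)%N -> (#|` M| <= m)%N ->
  `|y| = 1 -> `|y'| = 1 -> co y 0%N = 0 -> co y' 0%N = 0 ->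
  (forall i, i \notin M -> co y i = 0) ->
  (forall z N, (#|` N| <= m)%N -> (forall i, i \notin N -> co z i = 0) -> co z 0%N = 0 ->
    `|z| = 1 -> Num.max d `|y - z| = Num.max d `|y' - z|) ->
  twins M d (fun i => sgn1 (co y i)) y y'.
Proof.
move=> d0 d1 m0 Mm y1 y'1 y0 y'0 yM H.
have y1' : `|y| <= 1 by rewrite y1.
have y'1' : `|y'| <= 1 by rewrite y'1.
have He i (s : R) : (0 < i)%N -> `|s| = 1 ->
    Num.max d `|y - s *: e i| = Num.max d `|y' - s *: e i|.
  move=> i0 s1; apply: (H _ [fset i]).
  - by rewrite cardfs1.
  - by move=> k; rewrite inE (coZ hX) (co_e hX) => /negbTE ->; rewrite mulr0.
  - by rewrite (coZ hX) (co_e hX) ltn_eqF// mulr0.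
  - by rewrite normrZ s1 (norm_e hF hp hX) mulr1.
have n1 : `|1 : R| = 1 by rewrite normr1.
have nN1 : `|-1 : R| = 1 by rewrite normrN.
have Hm i : (0 < i)%N -> Num.max d `|y - e i| = Num.max d `|y' - e i|.
  by move=> i0; have := He i 1 i0 n1; rewrite scale1r.
have Hp i : (0 < i)%N -> Num.max d `|y + e i| = Num.max d `|y' + e i|.
  by move=> i0; have := He i (-1) i0 nN1; rewrite scaleN1r opprK.
have up i : 0 <= co y i -> 1 <= `|y + e i|.
  move=> yi; apply: le_trans (co_le hF hp hX _ i).
  by rewrite (coD hX) (co_e hX) eqxx (_ : true%:R = 1 :> R)// ger0_norm; lra.
have um i : co y i <= 0 -> 1 <= `|y - e i|.
  move=> yi; apply: le_trans (co_le hF hp hX _ i).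
  by rewrite (coB hX) (co_e hX) eqxx (_ : true%:R = 1 :> R)// ler0_norm; lra.
have pos i : 0 < co y i -> 0 < co y' i.
  move=> yi; have i0 : (0 < i)%N by rewrite lt0n; apply: contraTneq yi => ->; rewrite y0 ltxx.
  have dp : d < `|y + e i| by exact: lt_le_trans d1 (up i (ltW yi)).
  have lt' : `|y' - e i| < `|y' + e i|.
    by rewrite (max_eq_inv dp (Hp i i0)); exact: max_eq_lt dp (norm_add_e_lt y1' yi) (Hm i i0).
  have [y'i|//|y'i] := ltgtP (co y' i) 0; exfalso; move: lt'.
    by rewrite ltNge ltW// norm_add_e_gt.
  by rewrite norm_add_e_eq// ltxx.
have neg i : co y i < 0 -> co y' i < 0.
  move=> yi; have i0 : (0 < i)%N by rewrite lt0n; apply: contraTneq yi => ->; rewrite y0 ltxx.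
  have dm : d < `|y - e i| by exact: lt_le_trans d1 (um i (ltW yi)).
  have lt' : `|y' + e i| < `|y' - e i|.
    by rewrite (max_eq_inv dm (Hm i i0)); exact: max_eq_lt dm (norm_add_e_gt y1' yi) (Hp i i0).
  have [//|y'i|y'i] := ltgtP (co y' i) 0; exfalso; move: lt'.
    by rewrite ltNge ltW// norm_add_e_lt.
  by rewrite norm_add_e_eq// ltxx.
have zer i : co y i = 0 -> co y' i = 0.
  have [->//|] := eqVneq i 0%N; rewrite -lt0n => i0 yi.
  have dp : d < `|y + e i| by apply: lt_le_trans d1 (up i _); rewrite yi.
  have dm : d < `|y - e i| by rewrite norm_add_e_eq.
  have e' : `|y' - e i| = `|y' + e i|.
    by rewrite (max_eq_inv dm (Hm i i0)) (max_eq_inv dp (Hp i i0)) norm_add_e_eq.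
  have [y'i|y'i|//] := ltgtP (co y' i) 0; exfalso.
    by have := norm_add_e_gt y'1' y'i; rewrite e' ltxx.
  by have := norm_add_e_lt y'1' y'i; rewrite e' ltxx.
split=> //.
- move=> i; split=> [/zer//|y'i].
  by have [/neg|/pos|//] := ltgtP (co y i) 0; rewrite y'i ltxx.
- by move=> i; exact: norm_sgn1.
- move=> i; rewrite /sgn1; case: ifPn => yi; first by rewrite mul1r ger0_norm.
  by rewrite mulN1r ltr0_norm ?opprK// ltNge.
- move=> i; rewrite /sgn1; case: ifPn => [yi|].
    rewrite mul1r ger0_norm//; move: yi; rewrite le_eqVlt => /orP[/eqP/esym/zer->//|/pos/ltW//].
  by rewrite -ltNge => /neg yi; rewrite mulN1r ltr0_norm ?opprK.
- have := H y M Mm yM y0 y1; rewrite subrr normr0 distrC => h.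
  by have : `|y - y'| <= Num.max d `|y - y'| by [rewrite le_max lexx orbT]; rewrite -h; rewrite max_l// ltW.
- by move=> z zM; exact: H z M Mm zM.
Qed.

(** The points of level [s] with small support are fixed, so [y] and the image part [y'] have the
    same distances to them, truncated at |s - r|; this makes them twins. Only the size of the
    support is bounded, since test vectors have varying supports. *)
Lemma pole_isometry_step T T' m (d s r : R) :
  pole_isometry (e := e) T T' -> 0 < d -> (0 < m)%N -> 8 * d * m%:R <= 1 ->
  `|s| <= 1 -> `|r| <= 1 -> `|s - r| <= d ->
  (forall z N, (#|` N| <= m)%N -> (forall i, i \notin N -> co z i = 0) -> co z 0%N = 0 ->
    `|z| = 1 -> T (s *: e0 + z) = s *: e0 + z) ->
  forall y M, (#|` M| <= m)%N -> (forall i, i \notin M -> co y i = 0) -> co y 0%N = 0 ->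
    `|y| = 1 -> T (r *: e0 + y) = r *: e0 + y.
Proof.
move=> pT d0 m0 dm s1 r1 sr IH y M Mm yM y0 y1.
have m1 : 1 <= m%:R :> R by rewrite ler1n.
have d1 : d <= 8^-1 by have := ler_wpM2l (ltW d0) m1; lra.
have nrm (q : R) z : co z 0%N = 0 -> `|q| <= 1 -> `|z| = 1 -> `|q *: e0 + z| = 1.
  by move=> z0 q1 z1; rewrite (norm_pole hF hp hX)// z1; apply/max_idPr.
have ry1 := nrm _ _ y0 r1 y1.
have T1 : `|T (r *: e0 + y)| = 1 by exact: (bij_isom_fun (pole_isom pT)).
pose y' := offz (T (r *: e0 + y)).
have y'0 : co y' 0%N = 0 by exact: (co_off0 hX).
have TE : T (r *: e0 + y) = r *: e0 + y'.
  rewrite -{1}(off0K (e := e) (co := co) (T _)) (pole_isometry_co0 hF hp hX pT)//.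
  by have [-> _] := off0_pole hX r y0.
have dist z N : (#|` N| <= m)%N -> (forall i, i \notin N -> co z i = 0) -> co z 0%N = 0 ->
    `|z| = 1 -> Num.max `|r - s| `|y' - z| = Num.max `|r - s| `|y - z|.
  move=> Nm zN z0 z1; rewrite -!(dist_pole hF hp hX)// -TE -{1}(IH z N)//.
  by rewrite (bij_isom_dist (pole_isom pT))//; exact: nrm.
have rs : `|r - s| <= d by rewrite distrC.
(* Testing against [- y], at distance 2 from [y] and thus beyond the truncation, shows that [y'] has
   norm at least 1. *)
have y'1 : `|y'| = 1.
  apply/eqP; rewrite eq_le; apply/andP; split.
    by rewrite -T1; exact: (norm_off0_le hF hp hX).
  have := dist (- y) M Mm; rewrite opprK normrN (coN hX) y0 oppr0 => /(_ _ erefl y1).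
  have -> : `|y + y| = 2 by rewrite -mulr2n normrMn y1.
  rewrite [RHS]max_r; last lra.
  move=> H; have : Num.max `|r - s| `|y' + y| = 2.
    by apply: H => i /yM; rewrite (coN hX) => ->; rewrite oppr0.
  have := ler_normD y' y; rewrite y1.
  by rewrite maxEle; case: ifP => _ ? ?; lra.
have tw : twins M d (fun i => sgn1 (co y i)) y y'.
  apply: (twinsP d0 _ m0 Mm) => //; first lra.
  by move=> z N Nm zN z0 z1; apply: max_eq_le rs (esym (dist z N Nm zN z0 z1)).
rewrite TE -(twins_eq tw)//; apply: le_trans dm.
by rewrite ler_pM2l ?ler_nat// mulr_gt0.
Qed.

End Rigidity.

(** * From the face at [e_0] to the whole sphere *)

Section Tingley.
Context {R : realType} {F : set {fset nat}} (hF : schreier_like F) {p : R} (hp : 1 <= p).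
Context {X : normedModType R} {e : nat -> X} {co : X -> nat -> R}
  (hX : schreier_space F p e co).
Implicit Types (x y z : X) (T : X -> X).

Let p0 : 0 < p. Proof. exact: lt_le_trans hp. Qed.

Local Notation e0 := (e 0%N).
Local Notation offz := (off (e := e) (co := co) 0%N).

Definition fin_supp x := exists M : {fset nat}, forall i, i \notin M -> co x i = 0.

Lemma pole_isometry_fix_equator T T' : pole_isometry (e := e) T T' ->
  (forall y, co y 0%N = 0 -> `|y| <= 1 -> T (e0 + y) = e0 + y) ->
  forall y s, fin_supp y -> co y 0%N = 0 -> `|y| = 1 -> `|s| <= 1 ->
  T (s *: e0 + y) = s *: e0 + y.
Proof.
move=> pT Tfix y s [M yM] y0 y1 s1.
(* The successor makes [m] positive, also for empty [M]; [d] is the largest step allowed by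
   [pole_isometry_step]. *)
pose m := (#|` M|).+1; pose d : R := (8 * m%:R)^-1.
have m0 : 0 < m%:R :> R by rewrite ltr0n.
have d0 : 0 < d by rewrite invr_gt0 mulr_gt0.
have dm : 8 * d * m%:R = 1 by rewrite mulrAC mulfV// gt_eqF// mulr_gt0.
suff H : forall n (q : R), 1 - n%:R * d <= q -> `|q| <= 1 ->
    forall z N, (#|` N| <= m)%N -> (forall i, i \notin N -> co z i = 0) -> co z 0%N = 0 ->
    `|z| = 1 -> T (q *: e0 + z) = q *: e0 + z.
  (* [16 * m] steps of length [1 / (8 m)] cover the interval from 1 down to -1. *)
  apply: (H (16 * m)%N _ _ s1 y M) => //.
  rewrite natrM -mulrA [m%:R * d]mulrC.
  move: s1; rewrite ler_norml; lra.
elim=> [|n IH] q nq q1.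
  move=> z N _ _ z0 z1; have -> : q = 1.
    by move: q1 nq; rewrite ler_norml mul0r; lra.
  by rewrite scale1r Tfix// z1.
pose s' : R := Num.min 1 (q + d).
have ms : s' <= 1 /\ s' <= q + d by split; rewrite ge_min lexx ?orbT.
have sq : q <= s' by rewrite le_min; move: q1; rewrite ler_norml; lra.
have s'1 : `|s'| <= 1 by move: q1; rewrite !ler_norml; lra.
have ns' : 1 - n%:R * d <= s'.
  rewrite le_min; apply/andP; split; last by rewrite -natr1 mulrDl mul1r in nq; lra.
  by rewrite lerBlDr lerDl mulr_ge0// ltW.
apply: (pole_isometry_step hF hp hX pT d0 (ltn0Sn _) _ s'1 q1 _ (IH s' ns' s'1)).
- by rewrite dm.
- by rewrite ger0_norm; lra.
Qed.

(** Besides the points already settled there remains the open part of the face at [- e0]. By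
    [pole_isometry_opp] the map is linear there in [y], and it is the identity for [y] of norm 1,
    hence everywhere by homogeneity. *)
Lemma pole_isometry_fix_fin T T' : pole_isometry (e := e) T T' ->
  (forall y, co y 0%N = 0 -> `|y| <= 1 -> T (e0 + y) = e0 + y) ->
  forall x, fin_supp x -> `|x| = 1 -> T x = x.
Proof.
move=> pT Tfix x [M xM] x1.
set s := co x 0%N; set y := offz x.
have y0 : co y 0%N = 0 by exact: (co_off0 hX).
have ys : fin_supp y.
  by exists M => i /xM xi; rewrite /y (co_off hX) xi if_same.
have xE : x = s *: e0 + y by rewrite off0K.
have := norm_pole hF hp hX s y0; rewrite -xE x1 => x1E.
have s1 : `|s| <= 1 by rewrite x1E le_max lexx.
have y1 : `|y| <= 1 by rewrite x1E le_max lexx orbT.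
have [y1'|yn1] := eqVneq `|y| 1.
  by rewrite xE; exact: pole_isometry_fix_equator pT Tfix _ _ ys y0 y1' s1.
have s1' : `|s| = 1.
  by move: x1E yn1; case: (leP `|s| `|y|) => _ <-//; rewrite eqxx.
have [s1E|s1E] := norm_eq1 s1'.
  by rewrite xE s1E scale1r Tfix.
have [g [h [theta [gh _ _ _ gE]]]] := pole_isometry_linear hF hp hX (pole_isometry_opp pT).
have TN z : co z 0%N = 0 -> `|z| <= 1 -> T (- e0 + z) = - e0 + g z.
  move=> z0 z1; have := gE (- z); rewrite (coN hX) z0 oppr0 normrN => /(_ erefl z1).
  rewrite opprD opprK raddfN => /(congr1 -%R); rewrite opprK => ->.
  by rewrite opprD opprK.
rewrite xE s1E scaleN1r TN//; congr (_ + _).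
have [->|yn0] := eqVneq y 0; first by rewrite raddf0.
have yp : 0 < `|y| by rewrite normr_gt0.
pose u := `|y|^-1 *: y.
have u1 : `|u| = 1 by rewrite normrZ gtr0_norm ?invr_gt0// mulVf// gt_eqF.
have u0 : co u 0%N = 0 by rewrite (coZ hX) y0 mulr0.
have us : fin_supp u by case: ys => N yN; exists N => i /yN; rewrite (coZ hX) => ->; rewrite mulr0.
have : g u = u.
  apply: (@addrI _ (- e0)); rewrite -TN ?u1//.
  have nN1 : `|-1 : R| <= 1 by rewrite normrN normr1.
  have := pole_isometry_fix_equator pT Tfix us u0 u1 nN1.
  by rewrite scaleN1r.
have -> : y = `|y| *: u by rewrite scalerA mulfV ?gt_eqF// scale1r.
by move=> gu; rewrite linearZ/= gu.
Qed.

Lemma pole_isometry_fix T T' : pole_isometry (e := e) T T' ->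
  (forall y, co y 0%N = 0 -> `|y| <= 1 -> T (e0 + y) = e0 + y) ->
  forall x, `|x| = 1 -> T x = x.
Proof.
move=> pT Tfix x x1; apply/eqP; rewrite -subr_eq0 -normr_le0.
apply/ler_addgt0Pl => r r0; rewrite addr0.
(* The bound 1/2 keeps the truncation [z] nonzero. Truncating and normalizing cost [b] each, and
   both occur for [x] and for its image, so 4 b <= r is needed. *)
pose b := Num.min (2^-1) (r / 4).
have b0 : 0 < b by rewrite lt_min invr_gt0 ltr0n/= divr_gt0.
have b2 : b <= 2^-1 by rewrite ge_min lexx.
have br : b <= r / 4 by rewrite ge_min lexx orbT.
have [N xN] := fin_sum_approx hF hp hX x b0.
have {xN} := xN N (leqnn N); set z := fin_sum _ _ _ => xz.
have z1 : `| `|z| - 1| <= b by rewrite -x1 (le_trans (ler_dist_dist _ _))// distrC.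
have zp : 0 < `|z| by move: z1; rewrite ler_norml; lra.
pose u := `|z|^-1 *: z.
have u1 : `|u| = 1 by rewrite normrZ gtr0_norm ?invr_gt0// mulVf// gt_eqF.
have us : fin_supp u.
  by exists (initial N) => i iN; rewrite (coZ hX) (co_fin_sum hX) (negbTE iN) mulr0.
have zu : `|z - u| <= b.
  have -> : z - u = (`|z| - 1) *: u.
    by rewrite scalerBl scale1r scalerA mulfV ?gt_eqF// scale1r.
  by rewrite normrZ u1 mulr1.
have xu : `|x - u| <= b + b.
  by have := ler_distD z x u; lra.
have Tu := pole_isometry_fix_fin pT Tfix us u1.
have := ler_distD u (T x) x; rewrite -{1}Tu (bij_isom_dist (pole_isom pT))//.
by rewrite (distrC u x); lra.
Qed.

Lemma sphere_isometry_diag T T' : sphere_isometry T T' ->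
  exists theta : nat -> R, (forall i, theta i = 1 \/ theta i = -1) /\
    forall x, `|x| = 1 -> forall i, co (T x) i = theta i * co x i.
Proof.
move=> TT; have [t t1 [Te TNe]] := sphere_isometry_pole hF hp hX TT.
have tt : t * t = 1 by have [->|->] := norm_eq1 t1; rewrite ?mul1r// mulrNN mul1r.
have tS x : unit_sphere X x -> unit_sphere X (t *: x).
  by rewrite /unit_sphere/= normrZ t1 mul1r.
have tI : bij_isometry (unit_sphere X) (unit_sphere X) (fun x => t *: x) (fun x => t *: x).
  split=> //; try by move=> x _; rewrite scalerA tt scale1r.
  by move=> x y _ _; rewrite -scalerBr normrZ t1 mul1r.
have pT : pole_isometry (e := e) (fun x => t *: T x) (fun x => T' (t *: x)).
  split; first exact: (bij_isometry_comp TT tI).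
    by rewrite Te scalerA tt scale1r.
  by rewrite TNe scaleNr scalerN scalerA tt scale1r.
have [g [h [theta [gh ge0 th1 gE Tg]]]] := pole_isometry_linear hF hp hX pT.
have he0 : h e0 = e0 by rewrite -{1}ge0 (liK gh).
have hg := lin_isometry_sym gh.
have hI : bij_isometry (unit_sphere X) (unit_sphere X) h g.
  split.
  - by move=> x x1; rewrite /unit_sphere/= (li_norm hg).
  - by move=> x x1; rewrite /unit_sphere/= (li_norm gh).
  - by move=> x _; rewrite (liK hg).
  - by move=> x _; rewrite (liK' hg).
  - by move=> x y _ _; rewrite -raddfB (li_norm hg).
have pT2 : pole_isometry (e := e) (fun x => h (t *: T x)) (fun x => T' (t *: g x)).
  split; first exact: (bij_isometry_comp (pole_isom pT) hI).
    by rewrite (pole_fix pT) he0.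
  by rewrite (pole_fixN pT) linearN he0.
exists (fun i => t * theta i); split=> [i|x x1 i].
  by have [->|->] := norm_eq1 t1; have [->|->] := th1 i; rewrite ?mul1r ?mulN1r ?opprK; tauto.
have := pole_isometry_fix pT2 _ x1 => /(_ _)/(congr1 g); rewrite (liK' gh) => Tx.
have <- : t *: g x = T x.
  rewrite -Tx ?scalerA ?tt ?scale1r// => y y0 y1.
  by rewrite Tg// linearD he0 (liK gh).
by rewrite (coZ hX) gE mulrA.
Qed.

Lemma co_series (c : nat -> R) n i :
  co (series (fun k => c k *: e k) n) i = if (i < n)%N then c i else 0.
Proof.
elim: n => [|n IH]; first by rewrite /series/= big_geq// (co0 hX).
rewrite seriesSr (co_addZe hX) IH ltnS.
by case: (ltngtP i n) => [||->]; rewrite ?addr0 ?add0r.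
Qed.

(** The partial sums with the coefficients [co x] converge, so [get] chooses a valid sequence;
    continuity of the coordinates leaves no other. *)
Lemma schauder_coordE x : schauder_coord e x = co x.
Proof.
have xco : (series (fun i => co x i *: e i) @ \oo --> x)%classic.
  apply/cvgrPdist_le => r r0; have [N xN] := fin_sum_approx hF hp hX x r0.
  exists N => // n /= Nn; rewrite (_ : series _ n = fin_sum e (co x) (initial n)) ?xN//.
  by apply: (co_inj hp hX) => i; rewrite co_series (co_fin_sum hX) in_initial.
have : (series (fun i => schauder_coord e x i *: e i) @ \oo --> x)%classic.
  by apply: (@getPex _ [set c | (series (fun i => c i *: e i) @ \oo --> x)%classic]%classic);
    exists (co x).
set c := schauder_coord e x => /cvgrPdist_le cx; apply/funext => i.
apply/eqP; rewrite eq_sym -subr_eq0 -normr_le0; apply/ler_addgt0Pl => r r0; rewrite addr0.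
have [N _ xN] := cx r r0.
have := xN (maxn N i.+1) (leq_maxl _ _); apply: le_trans.
have := co_le hF hp hX (x - series (fun k => c k *: e k) (maxn N i.+1)) i.
by rewrite (coB hX) co_series leq_maxr.
Qed.

End Tingley.

Theorem theorem1p2 (d : Order.disp_t) (W : orderType d) (hW : is_omega1 W)
    (appr : W -> nat -> W) (S : W -> set {fset nat})
    (hS : transfinite_schreier appr S)
    (alpha : W) (halpha : ~ ord_zero alpha)
    (R : realType) (p : R) (hp : 1 <= p)
    (hgood : 1 < p -> p <> 2 -> good_schreier appr S)
    (X : completeNormedModType R) (iota : {linear c00 R -> X})
    (hX : is_completion (S alpha) p iota)
    (T : X -> X)
    (T_fun : set_fun (unit_sphere X) (unit_sphere X) T)
    (T_surj : set_surj (unit_sphere X) (unit_sphere X) T)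
    (T_isom : isometry_on (unit_sphere X) T) :
  exists theta : nat -> R,
    (forall i, theta i = 1 \/ theta i = -1) /\
    forall x, unit_sphere X x -> forall i,
      schauder_coord (fun k => iota (c00_basis R k)) (T x) i =
      theta i * schauder_coord (fun k => iota (c00_basis R k)) x i.
Proof.
have [Wwf _ _] := hW.
have hF := schreier_schreier_like Wwf hS halpha.
have hC := completion_schreier_space hF hp hX.
have /choice[T' T'P] : forall y, exists x, unit_sphere X y -> unit_sphere X x /\ T x = y.
  move=> y; have [/T_surj[x xS xy]|ny] := pselect (unit_sphere X y); first by exists x.
  (* Off the sphere the inverse takes the dummy value 0. *)
  by exists 0.
have TT : sphere_isometry T T'.
  split=> //; first by move=> y /T'P[].
    move=> x xS; have [T'S TT'] := T'P _ (T_fun _ xS).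
    apply/eqP; rewrite -subr_eq0 -normr_eq0 -T_isom//.
    by rewrite TT' subrr normr0.
  by move=> y /T'P[].
have [theta [th1 thE]] := sphere_isometry_diag hF hp hC TT.
exists theta; split=> // x xS i.
by rewrite !(schauder_coordE hF hp hC) thE.
Qed.
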